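(* Let $\mathcal C=\mathcal C(I,A,(\rho_i)_{i\in I},(C^a)_{a\in A})$ be a Cartan scheme such that $\mathcal R^{\mathrm{re}}(\mathcal C)$ is a finite root system of type $\mathcal C$. Let $a\in A$ and $u,v\in \operatorname{Hom}(\mathcal W(\mathcal C),a)$ such that $u\le_R v$. Let $J=I_L(u^{-1}v)$. If $u^{-1}v\neq w_J$ then the open interval $(u,v)$ in the weak order is contractible. If $u^{-1}v=w_J$ then $(u,v)$ is homotopy equivalent to a sphere of dimension $|J|-2$.
   Context: Cartan schemes. Let $I,A$ be finite sets, $A\neq\emptyset$, and $(\alpha_i)_{i\in I}$ the standard basis of $\mathbb Z^I$. A Cartan scheme $\mathcal C=\mathcal C(I,A,(\rho_i)_{i\in I},(C^a)_{a\in A})$ consists of maps $\rho_i:A\to A$ ($i\in I$) and generalized Cartan matrices $C^a=(c^a_{jk})_{j,k\in I}$ ($a\in A$), i.e. integer matrices with $c^a_{jj}=2$, $c^a_{jk}\le 0$ for $j\ne k$, and $c^a_{jk}=0$ implying $c^a_{kj}=0$, such that $\rho_i^2=\mathrm{id}$ and $c^a_{ij}=c^{\rho_i(a)}_{ij}$ for all $a\in A$, $i,j\in I$. Define $\sigma_i^a\in\operatorname{Aut}(\mathbb Z^I)$ by $\sigma_i^a(\alpha_j)=\alpha_j-c^a_{ij}\alpha_i$ for all $j\in I$. Weyl groupoid. $\mathcal W(\mathcal C)$ is the category (a groupoid) with object set $A$ whose morphisms are the compositions of the maps $\sigma_i^a$, each regarded as an element of $\operatorname{Hom}(a,\rho_i(a))$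 (morphisms with the same source and target are equal iff they are equal as linear maps). Upper indices are omitted when determined by context; $\mathrm{id}^a\sigma_{i_1}\cdots\sigma_{i_k}$ denotes the composition with target $a$. For a subgroupoid $\mathcal W'$ with object set $A$, $\operatorname{Hom}(\mathcal W',a)$ is the disjoint union over $b\in A$ of the sets of morphisms $b\to a$ in $\mathcal W'$. Roots. $(R^{\mathrm{re}})^a=\{\mathrm{id}^a\sigma_{i_1}\cdots\sigma_{i_k}(\alpha_j)\mid k\ge 0,\ i_1,\dots,i_k,j\in I\}$, and $\mathcal R^{\mathrm{re}}(\mathcal C)=(\mathcal C,((R^{\mathrm{re}})^a)_{a\in A})$. A family $(R^a)_{a\in A}$ of subsets of $\mathbb Z^I$ is a root system of type $\mathcal C$ if, with $R^a_+=R^a\cap\mathbb N_0^I$ and $m^a_{i,j}=|R^a\cap(\mathbb N_0\alpha_i+\mathbb N_0\alpha_j)|$: (R1) $R^a=R^a_+\cup -R^a_+$; (R2) $R^a\cap\mathbb Z\alpha_i=\{\alpha_i,-\alpha_i\}$; (R3) $\sigma_i^a(R^a)=R^{\rho_i(a)}$; (R4) if $i\ne j$ and $m^a_{i,j}$ is finite then $(\rho_i\rho_j)^{m^a_{i,j}}(a)=a$; for all $a\in A$, $i,j\in I$. It is finite if every $R^a$ is finite. Length and weak order. For a morphism $w$, $\ell(w)$ is the least $k\ge0$ such that $w$ is a composition $\sigma_{i_1}\cdots\sigma_{i_k}^b$. For $u\in\operatorname{Hom}(b,a)$, $v\in\operatorname{Hom}(c,b)$ put $u\le_R uv$ iff $\ell(u)+\ell(v)=\ell(uv)$;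 this is a partial order on $\operatorname{Hom}(\mathcal W(\mathcal C),a)$ (weak order). For $u\le_R v$, $(u,v)=\{w\mid u\le_R w\le_R v\}\setminus\{u,v\}$. Parabolics and longest words. For $J\subseteq I$, $\mathcal W_J(\mathcal C)$ is the smallest subgroupoid of $\mathcal W(\mathcal C)$ containing all objects and all $\sigma_j^b$ with $j\in J$, $b\in A$. For an object $b$, $w_J$ denotes the unique maximal element of $\operatorname{Hom}(\mathcal W_J(\mathcal C),b)$ with respect to weak order; it depends on $b$. In the claim, $w_J$ is taken with target object $b$, where $u\in\operatorname{Hom}(b,a)$, so that $u^{-1}v\in\operatorname{Hom}(\mathcal W(\mathcal C),b)$. Descents. For $w\in\operatorname{Hom}(\mathcal W(\mathcal C),b)$: $I_L(w)=\{i\in I\mid \mathrm{id}^b\sigma_i\le_R w\}$. Topology of posets. Topological properties of a poset $P$ refer to the geometric realization of its order complex $\Delta(P)$ (the simplicial complex of chains in $P$). The $(-1)$-dimensional sphere is the empty space. *)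

(* Defs.v *)
From HB Require Import structures.
From mathcomp Require Import all_boot all_order all_algebra.
From mathcomp Require Import finmap.
From mathcomp Require Import all_classical all_reals all_analysis.
Import Order.TTheory GRing.Theory Num.Theory.
Import numFieldNormedType.Exports.

Set Implicit Arguments.
Unset Strict Implicit.
Unset Printing Implicit Defensive.

Local Open Scope classical_set_scope.
Local Open Scope card_scope.
Local Open Scope ring_scope.

Definition generalized_cartan (I : finType) (c : I -> I -> int) : Prop :=
  [/\ forall j, c j j = 2,
      forall j k, j != k -> c j k <= 0
    & forall j k, c j k = 0 -> c k j = 0].

Record cartanScheme (I A : finType) := CartanScheme {
  rho : I -> A -> A;
  cartan : A -> I -> I -> int;
  obj_neq0 : (0 < #|A|)%N;
  cartan_gcm : forall a, generalized_cartan (cartan a);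
  rhoK : forall i, involutive (rho i);
  cartan_rho : forall a i j, cartan a i j = cartan (rho i a) i j }.

Notation lattice I := {ffun I -> int}.

Definition alpha (I : finType) (i : I) : lattice I :=
  [ffun j => (j == i)%:Z].

(* The Z-linear map determined by alpha_j |-> alpha_j - c^a_{ij} alpha_i
   (see sigma_alpha and sigma_linear). *)
Definition sigma (I A : finType) (C : cartanScheme I A) (i : I) (a : A)
    (x : lattice I) : lattice I :=
  \sum_(j : I) (alpha j - alpha i *~ cartan C a i j) *~ x j.

Lemma ffunMzE (I : finType) (x : lattice I) (z : int) k : (x *~ z) k = x k * z.
Proof.
rewrite -mulrzz; case: z => n /=; first by rewrite -!pmulrn ffunMnE.
by rewrite NegzE !mulrNz -!pmulrn ffunE ffunMnE.
Qed.

Section SigmaTheory.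
Variables (I A : finType) (C : cartanScheme I A).
Implicit Types (i j : I) (a : A) (x y : lattice I).

Lemma sigmaE i a x k :
  sigma C i a x k = x k - (k == i)%:Z * \sum_j cartan C a i j * x j.
Proof.
rewrite /sigma sum_ffunE.
under eq_bigr => j _ do rewrite ffunMzE !ffunE ffunMzE !ffunE mulrBl.
rewrite big_split /=; congr (_ + _).
  rewrite (bigD1 k) //= eqxx mul1r big1 ?addr0 // => j jk.
  by rewrite eq_sym (negbTE jk) mul0r.
rewrite -(big_morph _ (@opprD _) (@oppr0 _)) mulr_sumr.
by congr (- _); apply: eq_bigr => j _; rewrite mulrA.
Qed.

Lemma sigma_alpha i a j :
  sigma C i a (alpha j) = alpha j - alpha i *~ cartan C a i j.
Proof.
rewrite /sigma (bigD1 j) //= ffunE eqxx mulr1z big1 ?addr0 // => k kj.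
by rewrite ffunE (negbTE kj) mulr0z.
Qed.

Lemma sigma_linear i a (z : int) x y :
  sigma C i a (x *~ z + y) = sigma C i a x *~ z + sigma C i a y.
Proof.
rewrite /sigma mulrz_suml -big_split /=; apply: eq_bigr => j _.
rewrite ffunE ffunMzE mulrzDr; congr (_ + _).
by rewrite mulrzA.
Qed.

Lemma sigmaK i a : cancel (sigma C i a) (sigma C i (rho C i a)).
Proof.
move=> x; apply/ffunP => k; rewrite sigmaE sigmaE.
set S := \sum_j cartan C a i j * x j.
suff -> : \sum_j cartan C (rho C i a) i j * sigma C i a x j = - S.
  by rewrite mulrN opprK subrK.
transitivity (S - \sum_j (j == i)%:Z * (cartan C a i j * S)).
  rewrite -sumrB; apply: eq_bigr => j _.
  by rewrite sigmaE -cartan_rho mulrBr mulrCA.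
rewrite (bigD1 i) //= eqxx mul1r big1 ?addr0; last first.
  by move=> j /negbTE ->; rewrite mul0r.
have [-> _ _] := cartan_gcm C a.
by rewrite mulr_natl mulr2n opprD addrA subrr add0r.
Qed.

End SigmaTheory.

(* For a word s = i_1 ... i_k and an object a, the composition
   id^a sigma_{i_1} ... sigma_{i_k} has target a. Since sigma_i^b goes from b
   to rho_i b, its first factor is sigma_{i_1}^{rho_{i_1} a}, which has source
   rho_{i_1} a. *)
Fixpoint word_src (I A : finType) (C : cartanScheme I A) (a : A) (s : seq I) : A :=
  if s is i :: s' then word_src C (rho C i a) s' else a.

Fixpoint word_map (I A : finType) (C : cartanScheme I A) (a : A) (s : seq I) :
    lattice I -> lattice I :=
  if s is i :: s' then sigma C i (rho C i a) \o word_map C (rho C i a) s'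
  else id.

Definition is_word (I A : finType) (C : cartanScheme I A) (b a : A)
    (f : lattice I -> lattice I) (s : seq I) : Prop :=
  word_src C a s = b /\ word_map C a s = f.

(* Hom(b, a): a morphism b -> a is determined by its underlying linear map. *)
Record mor (I A : finType) (C : cartanScheme I A) (b a : A) := Mor {
  mor_map :> lattice I -> lattice I;
  mor_word : exists s, is_word C b a mor_map s }.

HB.instance Definition _ (I A : finType) (C : cartanScheme I A) (b a : A) :=
  gen_eqMixin (mor C b a).
HB.instance Definition _ (I A : finType) (C : cartanScheme I A) (b a : A) :=
  gen_choiceMixin (mor C b a).

Section Groupoid.
Variables (I A : finType) (C : cartanScheme I A).
Implicit Types (a b c : A) (i : I) (s t : seq I).

Lemma mor_eq b a (f g : mor C b a) : mor_map f = mor_map g -> f = g.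
Proof.
by case: f g => [f fP] [g gP] /= fg; subst g; congr Mor; exact: Prop_irrelevance.
Qed.

Lemma word_src_cat a s t :
  word_src C a (s ++ t) = word_src C (word_src C a s) t.
Proof. by elim: s a => //= i s IH a; exact: IH. Qed.

Lemma word_map_cat a s t :
  word_map C a (s ++ t) = word_map C a s \o word_map C (word_src C a s) t.
Proof. by elim: s a => //= i s IH a; rewrite IH. Qed.

Lemma word_src_rev a s : word_src C (word_src C a s) (rev s) = a.
Proof.
elim: s a => //= i s IH a.
by rewrite rev_cons -cats1 word_src_cat IH /= rhoK.
Qed.

Lemma word_map_rev a s :
  word_map C a s \o word_map C (word_src C a s) (rev s) = id.
Proof.
elim: s a => //= i s IH a.
rewrite rev_cons -cats1 word_map_cat word_src_rev /= rhoK.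
apply/funext => x /=.
have /(congr1 (fun f => f (sigma C i a x))) /= -> := IH (rho C i a).
exact: sigmaK.
Qed.

Definition word_mor a s : mor C (word_src C a s) a :=
  Mor (ex_intro _ s (conj erefl erefl)).

Definition mor_id a : mor C a a := word_mor a [::].

Fact sigma_mor_subproof i a : exists s, is_word C a (rho C i a) (sigma C i a) s.
Proof. by exists [:: i]; split => /=; rewrite rhoK. Qed.

Definition sigma_mor i a : mor C a (rho C i a) := Mor (sigma_mor_subproof i a).

Fact mor_comp_subproof c b a (f : mor C b a) (g : mor C c b) :
  exists s, is_word C c a (f \o g) s.
Proof.
case: f g => [f /= [s [sb sf]]] [g /= [t [tc tg]]]; exists (s ++ t).
by rewrite /is_word word_src_cat word_map_cat sb sf tg.
Qed.

Definition mor_comp c b a (f : mor C b a) (g : mor C c b) : mor C c a :=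
  Mor (mor_comp_subproof f g).

Fact mor_inv_subproof b a (f : mor C b a) :
  exists g : mor C a b,
    mor_comp f g = mor_id a /\ mor_comp g f = mor_id b.
Proof.
case: f => f [s [sb sf]]; have sP : exists t, is_word C a b
  (word_map C b (rev s)) t.
  by exists (rev s); rewrite /is_word -{1}sb word_src_rev.
exists (Mor sP); split; apply: mor_eq => /=.
  by rewrite -sb -sf word_map_rev.
have := word_map_rev b (rev s).
by rewrite revK -[in word_src C b _]sb word_src_rev sf.
Qed.

Definition mor_inv b a (f : mor C b a) : mor C a b :=
  projT1 (cid (mor_inv_subproof f)).

Fact length_subproof b a (f : mor C b a) :
  exists k, `[< exists s, size s = k /\ is_word C b a f s >].
Proof. by case: (mor_word f) => s fs; exists (size s); apply/asboolP; exists s. Qed.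

Definition length b a (f : mor C b a) : nat := ex_minn (length_subproof f).

(* Hom(W(C), a), the disjoint union over b of the sets Hom(b, a); the source b
   of w is tag w. *)
Definition homTo a := {b : A & mor C b a}.
HB.instance Definition _ a := Choice.on (homTo a).

Definition homset b a (f : mor C b a) : homTo a := Tagged (mor C ^~ a) f.

(* u^-1 v, which has target b if u is in Hom(b, a). *)
Definition ldiv a (u v : homTo a) : homTo (tag u) :=
  homset (mor_comp (mor_inv (tagged u)) (tagged v)).

Definition weak_le a (u v : homTo a) : Prop :=
  exists w : mor C (tag v) (tag u),
    mor_comp (tagged u) w = tagged v /\
    (length (tagged u) + length w = length (tagged v))%N.

Definition weak_interval a (u v : homTo a) : set (homTo a) :=
  [set w | weak_le u w /\ weak_le w v] `\` [set u; v].

Definition left_descents b (w : homTo b) : {set I} :=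
  [set i : I | `[< weak_le (homset (word_mor b [:: i])) w >]].

Definition subgroupoid (S : forall b a, set (mor C b a)) : Prop :=
  [/\ forall a, S a a (mor_id a),
      forall c b a (f : mor C b a) (g : mor C c b),
        S b a f -> S c b g -> S c a (mor_comp f g)
    & forall b a (f : mor C b a), S b a f -> S a b (mor_inv f)].

Definition parabolic (J : {set I}) b a : set (mor C b a) :=
  [set f | forall S : forall b a, set (mor C b a), subgroupoid S ->
     (forall j c, j \in J -> S c (rho C j c) (sigma_mor j c)) -> S b a f].

Definition parabolic_hom (J : {set I}) b : set (homTo b) :=
  [set w : homTo b | parabolic J (tagged w)].

Definition weak_maximal b (X : set (homTo b)) : set (homTo b) :=
  [set w | X w /\ forall x, X x -> weak_le w x -> x = w].

(* w_J with target b: the unique maximal element of Hom(W_J(C), b). The default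
   value id^b is only taken if there is no unique maximal element. *)
Definition longest (J : {set I}) b : homTo b :=
  xget (homset (mor_id b))
       [set w | weak_maximal (@parabolic_hom J b) = [set w]].

Definition real_roots a : set (lattice I) :=
  [set x | exists s j, x = word_map C a s (alpha j)].

Definition nonneg_lattice : set (lattice I) := [set x | forall i, 0 <= x i].

(* The clause for m^a_{i,j} quantifies over the natural number m that is the
   cardinality of R^a inside N_0 alpha_i + N_0 alpha_j; there is such an m
   exactly when that set is finite. *)
Definition root_system (R : A -> set (lattice I)) : Prop :=
  [/\ forall a, let Rp := R a `&` nonneg_lattice in
        R a = Rp `|` [set - x | x in Rp],
      forall a i,
        R a `&` [set x | exists z : int, x = alpha i *~ z] =
        [set alpha i; - alpha i],
      forall a i, [set sigma C i a x | x in R a] = R (rho C i a)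
    & forall a i j (m : nat), i != j ->
        R a `&` [set x | exists p q : nat, x = alpha i *+ p + alpha j *+ q]
          #= `I_m ->
        iter m (rho C i \o rho C j) a = a].

Definition finite_root_system (R : A -> set (lattice I)) : Prop :=
  root_system R /\ forall a, finite_set (R a).

End Groupoid.

Definition order_complex (T : choiceType) (le : T -> T -> Prop) (P : set T) :
    set {fset T} :=
  [set s | [/\ s != fset0, [set` s] `<=` P & total_on [set` s] le]].

(* |K| in barycentric coordinates. A point belongs to the closed simplex |s| iff
   its coordinates vanish outside s. *)
Record realization (R : realType) (T : choiceType) (K : set {fset T}) := Point {
  coord :> T -> R;
  coord_ge0 : forall t, 0 <= coord t;
  coord_simplex : exists s, [/\ K s, forall t, t \notin s -> coord t = 0
                                   & \sum_(t <- s) coord t = 1] }.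

HB.instance Definition _ (R : realType) (T : choiceType) (K : set {fset T}) :=
  gen_eqMixin (realization R K).
HB.instance Definition _ (R : realType) (T : choiceType) (K : set {fset T}) :=
  gen_choiceMixin (realization R K).

Section Realization.
Variables (R : realType) (T : choiceType) (K : set {fset T}).

Definition closed_simplex (s : {fset T}) : set (realization R K) :=
  [set x | forall t, t \notin s -> x t = 0].

(* The weak (coherent) topology: U is open iff its trace on each closed simplex
   is open for the topology of that simplex as a subspace of R^T. *)
Definition realization_open : set_system (realization R K) :=
  [set U | forall s, K s -> exists W : set {ptws T -> R}, open W /\
     closed_simplex s `&` U =
     closed_simplex s `&` [set x : realization R K | W (x : T -> R)]].

Lemma realization_openT : realization_open setT.
Proof. by move=> s _; exists setT; split => //; exact: openT. Qed.

Lemma realization_openI : setI_closed realization_open.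
Proof.
move=> U V oU oV s Ks; have [W [oW UW]] := oU s Ks.
have [W' [oW' VW]] := oV s Ks; exists (W `&` W'); split; first exact: openI.
by rewrite -[closed_simplex s]setIid setIACA UW VW setIACA.
Qed.

Lemma realization_open_bigU (J : Type) (f : J -> set (realization R K)) :
  (forall j, realization_open (f j)) -> realization_open (\bigcup_j f j).
Proof.
move=> oF s Ks; pose W j := projT1 (cid (oF j s Ks)).
have WP j := projT2 (cid (oF j s Ks)).
exists (\bigcup_j W j); split; first by apply: bigcup_open => j _; case: (WP j).
apply/seteqP; split=> x [sx [j _ jx]]; split => //; exists j => //.
  have [_ e] := WP j.
  by have : (closed_simplex s `&` f j) x by []; rewrite e => -[].
have [_ e] := WP j.
suff : (closed_simplex s `&` f j) x by case.
by rewrite e.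
Qed.

HB.instance Definition _ := isOpenTopological.Build (realization R K)
  realization_openT realization_openI realization_open_bigU.

End Realization.

Section Homotopy.
Variable R : realType.

Definition homotopic (X Y : topologicalType) (f g : X -> Y) : Prop :=
  exists H : X * R -> Y,
    [/\ {within [set: X] `*` `[0, 1], continuous H},
        forall x, H (x, 0) = f x & forall x, H (x, 1) = g x].

Definition contractible (X : topologicalType) : Prop :=
  exists x0 : X, homotopic idfun (fun=> x0).

Definition homotopy_equivalent (X Y : topologicalType) : Prop :=
  exists (f : X -> Y) (g : Y -> X),
    [/\ continuous f, continuous g,
        homotopic (g \o f) idfun & homotopic (f \o g) idfun].

Definition unit_sphere (n : nat) : set 'rV[R]_n :=
  [set x | \sum_(i < n) x ord0 i ^+ 2 = 1].

(* The sphere of dimension d is the unit sphere of R^(d+1) for d >= 0, and the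
   empty space (the unit sphere of R^0) for d < 0. *)
Definition sphere (d : int) : topologicalType :=
  @unit_sphere (if d is Posz n then n.+1 else 0%N).

End Homotopy.

(* Main.v *)
(* By left translation the interval (u, v) becomes an interval (id, w), with
   w = u^-1 v.  A Humphreys-style induction, whose rank two case rests on axiom
   (R4), shows that the length of a morphism is its number of inversions.  Hence
   K is contained in I_L(x) if and only if w_K <= x, and p |-> w_{I_L(p)} is a
   monotone retraction of the interval lying below the identity.  Moving the
   mass of a point of the order complex along this retraction, starting from the
   bottom of its chain, deforms the realization onto that of the elements w_K.
   If w is not w_J, all nonempty K in J occur, and w_J is a maximum of the image.
   If w = w_J, exactly the proper nonempty K occur.  A point of the order complex
   of these is described by the function y_j = (total mass of the K containing j)
   on J, with minimum 0 and maximum 1; modulo translation and scaling these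
   functions form the unit sphere of R^J / R. *)
Require Import Defs.
From mathcomp Require Import all_boot all_order all_algebra.
From mathcomp Require Import finmap zify ring lra.
From mathcomp Require Import all_classical all_reals all_analysis.
Import Order.TTheory GRing.Theory Num.Theory.
Import numFieldNormedType.Exports.

Set Implicit Arguments.
Unset Strict Implicit.
Unset Printing Implicit Defensive.

Local Open Scope classical_set_scope.
Local Open Scope ring_scope.

(** * Words in the simple reflections *)

(** Axiom (R4) speaks of objects only: it makes the two alternating words in [i] and [j] of the
    right length end in the same object. That they also agree as linear maps must be extracted from
    the positivity of roots, and this is the content of the braid relation. Since the Cartan matrix
    varies with the object, there is no single reflection representation, and roots are carried
    along words instead. On the topological side the obstacle is that for [p <= q] the elements [p]
    and [w_{I_L(q)}] need not be comparable. A straight-line homotopy may therefore leave the order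
    complex, and the order in which mass moves matters. For the sphere, a function on [J] is turned
    back into masses by its jumps: the mass at [w_K] is the amount by which the values on [K] exceed
    those off [K]. It is nonzero only for upper level sets, and these form a chain. *)

Section Words.
Variables (I A : finType) (C : cartanScheme I A).
Implicit Types (a b : A) (i j k : I) (s t r : seq I) (x y : lattice I).
Implicit Types K : {set I}.

Notation src := (word_src C).
Notation wmap := (word_map C).
Notation rho := (rho C).

(** The inverse of [word_map C a s], read from the target [a]. The inversions of a word are the
    positive roots at its target that this map makes negative. *)
Fixpoint back a s x : lattice I :=
  if s is i :: s' then back (rho i a) s' (sigma C i a x) else x.

Lemma back_cat a s t x : back a (s ++ t) x = back (src a s) t (back a s x).
Proof. by elim: s a x => //= i s IH a x; rewrite IH. Qed.

Lemma backE a s : back a s = wmap (src a s) (rev s).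
Proof.
elim: s a => //= i s IH a; apply/funext => x.
by rewrite rev_cons -cats1 word_map_cat /= word_src_rev rhoK IH.
Qed.

Lemma word_mapK a s : cancel (wmap a s) (back a s).
Proof.
move=> x; have := word_map_rev C (src a s) (rev s).
by rewrite word_src_rev revK backE => /(congr1 (fun f => f x)).
Qed.

Lemma backK a s : cancel (back a s) (wmap a s).
Proof.
move=> x; have := word_map_rev C a s.
by rewrite backE => /(congr1 (fun f => f x)).
Qed.

Lemma back_rev a s x : back (src a s) (rev s) x = wmap a s x.
Proof. by rewrite backE revK word_src_rev. Qed.

Lemma sigmaD i a x y : sigma C i a (x + y) = sigma C i a x + sigma C i a y.
Proof. by have := sigma_linear C i a 1 x y; rewrite !mulr1z. Qed.

Lemma sigma0 i a : sigma C i a 0 = 0.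
Proof. by apply: (@addrI _ (sigma C i a 0)); rewrite -sigmaD !addr0. Qed.

Lemma sigmaZ i a (z : int) x : sigma C i a (x *~ z) = sigma C i a x *~ z.
Proof. by rewrite -[x *~ z]addr0 sigma_linear sigma0 addr0. Qed.

Lemma sigmaN i a x : sigma C i a (- x) = - sigma C i a x.
Proof. by rewrite -[- x]mulrN1z sigmaZ mulrN1z. Qed.

Lemma sigma_alpha_self i a : sigma C i a (alpha i) = - alpha i.
Proof.
rewrite sigma_alpha; have [-> _ _] := cartan_gcm C a.
by rewrite -pmulrn mulr2n opprD addrA subrr add0r.
Qed.

Lemma backD a s x y : back a s (x + y) = back a s x + back a s y.
Proof. by elim: s a x y => //= i s IH a x y; rewrite sigmaD IH. Qed.

Lemma back0 a s : back a s 0 = 0.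
Proof. by elim: s a => //= i s IH a; rewrite sigma0 IH. Qed.

Lemma backN a s x : back a s (- x) = - back a s x.
Proof. by elim: s a x => //= i s IH a x; rewrite sigmaN IH. Qed.

Lemma backZ a s z x : back a s (x *~ z) = back a s x *~ z.
Proof. by elim: s a x => //= i s IH a x; rewrite sigmaZ IH. Qed.

Lemma lattice_sum x : x = \sum_k alpha k *~ x k.
Proof.
apply/ffunP => l; rewrite sum_ffunE (bigD1 l) //= Defs.ffunMzE ffunE eqxx mul1r.
rewrite big1 ?addr0 // => k kl; rewrite Defs.ffunMzE ffunE eq_sym (negbTE kl).
by rewrite mul0r.
Qed.

Lemma back_sum a s x l : back a s x l = \sum_k back a s (alpha k) l * x k.
Proof.
rewrite {1}[x]lattice_sum (big_morph _ (backD a s) (back0 a s)) sum_ffunE.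
by apply: eq_bigr => k _; rewrite backZ Defs.ffunMzE.
Qed.

Lemma alphaE i k : alpha i k = (k == i)%:Z. Proof. by rewrite ffunE. Qed.

Definition nneg x := [forall i, 0 <= x i].

Lemma nnegP x : reflect (forall i, 0 <= x i) (nneg x).
Proof. exact: forallP. Qed.

Lemma nneg_alpha i : nneg (alpha i).
Proof. by apply/nnegP => k; rewrite alphaE; case: (_ == _). Qed.

Lemma nneg_antisym x : nneg x -> nneg (- x) -> x = 0.
Proof.
move=> /nnegP h /nnegP h'; apply/ffunP => k; apply/eqP.
by have := h' k; rewrite !ffunE oppr_ge0 eq_le h => ->.
Qed.

Lemma nneg_back a s x K : (forall i, i \in K -> nneg (back a s (alpha i))) ->
  nneg x -> (forall i, i \notin K -> x i = 0) -> nneg (back a s x).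
Proof.
move=> h /nnegP x0 xK; apply/nnegP => l; rewrite back_sum sumr_ge0 // => k _.
have [kK|/xK ->] := boolP (k \in K); last by rewrite mulr0.
by rewrite mulr_ge0 //; apply/nnegP/h.
Qed.

Lemma back_letters a s x k : k \notin s -> back a s x k = x k.
Proof.
elim: s a x => //= i s IH a x; rewrite inE negb_or => /andP[ki ks].
by rewrite IH // sigmaE (negbTE ki) mul0r subr0.
Qed.

(** Equality in [homTo C a] of the morphisms spelled by two words. Arguing on words avoids
    transporting morphisms along equalities of their sources. *)
Definition eqw a s t := src a s = src a t /\ wmap a s = wmap a t.

Lemma eqw_sym a s t : eqw a s t -> eqw a t s. Proof. by case. Qed.

Lemma eqw_trans a s t r : eqw a s t -> eqw a t r -> eqw a s r.
Proof. by move=> [e1 e2] [e3 e4]; split; [rewrite e1|rewrite e2]. Qed.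

Lemma eqw_back a s t : eqw a s t -> back a s = back a t.
Proof.
move=> [_ e]; apply/funext => x.
by rewrite -[RHS](word_mapK a s) e backK.
Qed.

Lemma back_eqw a s t : src a s = src a t -> back a s =1 back a t -> eqw a s t.
Proof.
by move=> e h; split=> //; apply/funext => x; rewrite -[RHS](backK a s) h word_mapK.
Qed.

Lemma eqw_catr a s t r : eqw a s t -> eqw a (s ++ r) (t ++ r).
Proof. by move=> [e1 e2]; split; rewrite ?word_src_cat ?word_map_cat e1 ?e2. Qed.

Lemma eqw_catl a r s t : eqw (src a r) s t -> eqw a (r ++ s) (r ++ t).
Proof. by move=> [e1 e2]; split; rewrite ?word_src_cat ?word_map_cat ?e1 ?e2. Qed.

Lemma eqw_cons a i s t : eqw (rho i a) s t -> eqw a (i :: s) (i :: t).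
Proof. exact: (@eqw_catl a [:: i]). Qed.

Lemma eqw_catK a r s t : eqw a (r ++ s) (r ++ t) -> eqw (src a r) s t.
Proof.
move=> e; have [e1 _] := e; apply: back_eqw; first by rewrite -!word_src_cat.
by move=> x; rewrite -(word_mapK a r x) -!back_cat (eqw_back e).
Qed.

Lemma eqw_ii a i s : eqw a [:: i, i & s] s.
Proof.
by apply: back_eqw => /= [|x]; rewrite rhoK ?sigmaK.
Qed.

Lemma eqw_rev a s : eqw (src a s) (rev s ++ s) [::].
Proof.
apply: back_eqw; first by rewrite word_src_cat word_src_rev.
by move=> x; rewrite back_cat back_rev word_src_rev word_mapK.
Qed.

Lemma eqw_revr a s : eqw a (s ++ rev s) [::].
Proof. by have := eqw_rev (src a s) (rev s); rewrite word_src_rev revK. Qed.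

End Words.

(** * Roots and inversions *)

Section Roots.
Variables (I A : finType) (C : cartanScheme I A).
Hypothesis hC : finite_root_system C (real_roots C).
Implicit Types (a b : A) (i j k : I) (s t r : seq I) (x y : lattice I).
Implicit Types K : {set I}.

Notation src := (word_src C).
Notation wmap := (word_map C).
Notation rho := (rho C).
Notation R := (real_roots C).
Notation back := (back C).
Notation eqw := (eqw C).

Lemma root_back a s x : R a x -> R (src a s) (back a s x).
Proof.
move=> [t [j ->]]; exists (rev s ++ t), j.
by rewrite word_map_cat word_src_rev backE.
Qed.

Lemma root_wmap a s x : R (src a s) x -> R a (wmap a s x).
Proof. by move=> /(@root_back _ (rev s)); rewrite back_rev word_src_rev. Qed.

Lemma root_alpha a i : R a (alpha i).
Proof. by exists [::], i. Qed.

Lemma root_ray a i x (z : int) : R a x -> x = alpha i *~ z ->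
  x = alpha i \/ x = - alpha i.
Proof.
move=> Rx xz; have [[_ R2 _ _] _] := hC.
suff : (R a `&` [set x | exists z : int, x = alpha i *~ z]) x by rewrite R2.
by split=> //; exists z.
Qed.

Lemma root_Nalpha a i : R a (- alpha i).
Proof.
have [[_ R2 _ _] _] := hC.
suff : (R a `&` [set x | exists z : int, x = alpha i *~ z]) (- alpha i) by case.
by rewrite R2; right.
Qed.

Lemma root_opp a x : R a x -> R a (- x).
Proof.
move=> [s [j ->]]; rewrite -back_rev -backN back_rev.
exact/root_wmap/root_Nalpha.
Qed.

Lemma alpha_neq0 i : alpha i != 0 :> lattice I.
Proof.
by apply/eqP => /(congr1 (fun x : lattice I => x i)); rewrite !ffunE eqxx.
Qed.

Lemma root_neq0 a x : R a x -> x != 0.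
Proof.
move=> Rx; have [_ [j _]] := Rx; apply/eqP => x0.
have [] := root_ray (i := j) (z := 0) Rx; first by rewrite mulr0z.
  by rewrite x0 => /esym/eqP; rewrite (negbTE (alpha_neq0 j)).
by rewrite x0 => /esym/eqP; rewrite oppr_eq0 (negbTE (alpha_neq0 j)).
Qed.

Lemma root_nnegN a x : R a x -> nneg (- x) = ~~ nneg x.
Proof.
move=> Rx; apply/idP/idP => [xN|].
  apply/negP => xp; have /eqP := nneg_antisym xp xN.
  by rewrite (negbTE (root_neq0 Rx)).
have [[R1 _ _ _] _] := hC; move: Rx; rewrite R1 => -[[_ x0]|[y [_ y0] <-]].
  by case/negP; apply/nnegP.
by rewrite opprK => _; apply/nnegP.
Qed.

Lemma root_nneg_coord a x k : R a x -> 0 < x k -> nneg x.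
Proof.
move=> Rx xk; apply/negPn; rewrite -(root_nnegN Rx); apply/negP => /nnegP/(_ k).
by rewrite ffunE oppr_ge0 leNgt xk.
Qed.

Lemma root_eq_alpha a i x : R a x -> nneg x -> (forall k, k != i -> x k = 0) ->
  x = alpha i.
Proof.
move=> Rx x0 h; have xE : x = alpha i *~ x i.
  rewrite {1}[x]lattice_sum (bigD1 i) //= big1 ?addr0 // => k /h ->.
  by rewrite mulr0z.
have [//|xN] := root_ray Rx xE; have := root_nnegN Rx.
by rewrite x0 xN opprK nneg_alpha.
Qed.

Lemma root_sigma a i x : R a x -> R (rho i a) (sigma C i a x).
Proof. exact: (@root_back a [:: i]). Qed.

(** Only the coordinate at [i] changes under [sigma C i a]. A positive root that became negative
    would vanish at all other coordinates, and (R2) makes it [alpha i]. *)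
Lemma sigma_nneg a i x : R a x -> nneg x -> x != alpha i ->
  nneg (sigma C i a x).
Proof.
move=> Rx x0; apply: contraNT; rewrite -(root_nnegN (root_sigma i Rx)) => /nnegP h.
apply/eqP/(root_eq_alpha Rx) => // k ki.
have := h k; rewrite ffunE sigmaE (negbTE ki) mul0r subr0 oppr_ge0 => xk.
by apply/eqP; rewrite eq_le xk; apply/nnegP.
Qed.

Definition roots a : {fset lattice I} := fset_set (R a).

Lemma mem_roots a x : reflect (R a x) (x \in roots a).
Proof.
have [_ /(_ a) fin] := hC.
by rewrite in_fset_set //; apply/(iffP idP) => [/set_mem|/mem_set].
Qed.

Definition supported K x := [forall i, (i \notin K) ==> (x i == 0)].

Lemma supportedP K x :
  reflect (forall i, i \notin K -> x i = 0) (supported K x).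
Proof.
apply: (iffP forallP) => [h i iK|h i]; first by apply/eqP/(implyP (h i)).
by apply/implyP => /h ->.
Qed.

Definition posroots K a : seq (lattice I) :=
  [seq x <- roots a | nneg x && supported K x].

Lemma mem_posroots K a x :
  x \in posroots K a = [&& nneg x, supported K x & x \in roots a].
Proof. by rewrite mem_filter andbA. Qed.

(** The count is relative to [K] because three cases occur: a pair for the braid relation, all of
    [I] for the length, an arbitrary [K] for [w_K]. *)
Definition inv K a s := count (fun x => ~~ nneg (back a s x)) (posroots K a).

Lemma inv_nil K a : inv K a [::] = 0%N.
Proof.
apply/eqP; rewrite -leqn0 leqNgt -has_count -all_predC; apply/allP => x.
by rewrite mem_posroots /= negbK => /andP[].
Qed.

Lemma inv_eqw K a s t : eqw a s t -> inv K a s = inv K a t.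
Proof. by move=> /eqw_back; rewrite /inv => ->. Qed.

Lemma alpha_posroots K a i : i \in K -> alpha i \in posroots K a.
Proof.
move=> iK; rewrite mem_posroots nneg_alpha /=; apply/andP; split; last first.
  exact/mem_roots/root_alpha.
apply/supportedP => k kK; rewrite alphaE.
by case: eqP => // e; rewrite e iK in kK.
Qed.

Lemma uniq_posroots K a : uniq (posroots K a).
Proof. exact/filter_uniq/fset_uniq. Qed.

Lemma sigma_posroots K a i x : i \in K -> x \in posroots K a -> x != alpha i ->
  (sigma C i a x \in posroots K (rho i a)) && (sigma C i a x != alpha i).
Proof.
move=> iK; rewrite !mem_posroots => /and3P[x0 /supportedP xK /mem_roots Rx] xi.
rewrite (sigma_nneg Rx) //=; apply/andP; split; [apply/andP; split|].
- apply/supportedP => k kK; rewrite sigmaE xK //.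
  by case: eqP => [e|]; [rewrite e iK in kK|rewrite mul0r subr0].
- exact/mem_roots/root_sigma.
apply/eqP => e; have := sigmaK C i a x; rewrite e sigma_alpha_self => xN.
by have := root_nnegN Rx; rewrite -xN opprK nneg_alpha xN x0.
Qed.

Lemma posroots_perm K a i : i \in K ->
  perm_eq (posroots K (rho i a))
    (alpha i :: [seq sigma C i a x | x <- rem (alpha i) (posroots K a)]).
Proof.
move=> iK; apply: perm_trans (perm_to_rem (alpha_posroots _ iK)) _.
rewrite perm_cons; apply: uniq_perm.
- exact/rem_uniq/uniq_posroots.
- rewrite map_inj_uniq; first exact/rem_uniq/uniq_posroots.
  exact: can_inj (sigmaK C i a).
move=> y; rewrite (rem_filter _ (uniq_posroots _ _)) mem_filter /=.
apply/andP/mapP => [[yi yP]|[x]].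
  exists (sigma C i (rho i a) y).
    rewrite (rem_filter _ (uniq_posroots _ _)) mem_filter /= andbC.
    by have := sigma_posroots iK yP yi; rewrite rhoK.
  by have := sigmaK C i (rho i a) y; rewrite rhoK.
rewrite (rem_filter _ (uniq_posroots _ _)) mem_filter /= => /andP[xi xP] ->.
by apply/andP; rewrite andbC sigma_posroots.
Qed.

Lemma subset_tl K i s : {subset i :: s <= K} -> {subset s <= K}.
Proof. by move=> sK k ks; rewrite sK // inE ks orbT. Qed.

Lemma size_posroots_src K a s : {subset s <= K} ->
  size (posroots K (src a s)) = size (posroots K a).
Proof.
elim: s a => //= i s IH a sK; rewrite IH; last exact: subset_tl sK.
have iK : i \in K by rewrite sK // inE eqxx.
rewrite (perm_size (posroots_perm a iK)) /= size_map size_rem ?alpha_posroots //.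
by rewrite prednK // -has_predT; apply/hasP; exists (alpha i) => //; apply: alpha_posroots.
Qed.

(* Passing from [s] to [i :: s] moves a single root, namely [alpha i], between
   the inverted and the non-inverted ones. *)
Lemma inv_cons K a i s : i \in K ->
  (inv K a (i :: s) + ~~ nneg (back (rho i a) s (alpha i)) =
   inv K (rho i a) s + nneg (back (rho i a) s (alpha i)))%N.
Proof.
move=> iK; rewrite /inv.
rewrite (permP (posroots_perm a iK)) /= count_map.
rewrite (permP (perm_to_rem (alpha_posroots a iK))) /= sigma_alpha_self backN.
rewrite (root_nnegN (root_back _ (root_alpha (rho i a) i))) negbK.
by rewrite addnAC [in RHS]addnAC; congr (_ + _)%N; rewrite addnC.
Qed.

Lemma inv_bound K a s : {subset s <= K} -> (inv K a s <= size s)%N.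
Proof.
elim: s a => [|i s IH] a sK; first by rewrite inv_nil.
have := IH (rho i a) (subset_tl sK).
have := inv_cons a s (sK i (mem_head i s)).
by case: (nneg _) => /=; lia.
Qed.

Lemma inv_odd K a s : {subset s <= K} -> odd (inv K a s) = odd (size s).
Proof.
elim: s a => [|i s IH] a sK; first by rewrite inv_nil.
have := IH (rho i a) (subset_tl sK).
have := inv_cons a s (sK i (mem_head i s)).
by case: (nneg _) => /=; lia.
Qed.

Lemma nneg_backN a s x K :
  (forall i, i \in K -> ~~ nneg (back a s (alpha i))) -> nneg x -> supported K x ->
  nneg (- back a s x).
Proof.
move=> h /nnegP x0 /supportedP xK; apply/nnegP => l.
rewrite ffunE back_sum -sumrN sumr_ge0 // => k _.
have [kK|/xK ->] := boolP (k \in K); last by rewrite mulr0 oppr0.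
rewrite -mulNr mulr_ge0 //; have := h k kK.
rewrite -(root_nnegN (root_back _ (root_alpha a k))) => /nnegP/(_ l).
by rewrite ffunE.
Qed.

Lemma inv_full K a s : (forall i, i \in K -> ~~ nneg (back a s (alpha i))) ->
  inv K a s = size (posroots K a).
Proof.
move=> h; apply/eqP; rewrite /inv -all_count; apply/allP => x.
rewrite mem_posroots => /and3P[x0 xK /mem_roots Rx].
by rewrite -(root_nnegN (root_back _ Rx)); apply: nneg_backN h x0 xK.
Qed.

Lemma inv_fullP K a s : inv K a s = size (posroots K a) ->
  forall x, x \in posroots K a -> ~~ nneg (back a s x).
Proof. by move=> /eqP; rewrite -all_count => /allP. Qed.

End Roots.

(** * Rank two and the braid relation *)

Section Dihedral.
Variables (I A : finType) (C : cartanScheme I A).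
Hypothesis hC : finite_root_system C (real_roots C).
Implicit Types (a b : A) (s t r : seq I) (x y : lattice I).

Notation rho := (rho C).
Notation back := (back C).
Notation inv := (inv C).
Notation posroots := (posroots C).

Fixpoint alt (i j : I) n := if n is n'.+1 then i :: alt j i n' else [::].

Lemma size_alt i j n : size (alt i j n) = n.
Proof. by elim: n i j => //= n IH i j; rewrite IH. Qed.

Lemma alt_letters i j n : {subset alt i j n <= [set i; j]%SET}.
Proof.
elim: n i j => //= n IH i j k. rewrite inE => /orP[/eqP ->|/IH].
  by rewrite !inE eqxx.
by rewrite !inE orbC.
Qed.

Lemma alt_addn i j n m : exists r, alt i j (n + m) = alt i j n ++ r.
Proof.
elim: n i j => [|n IH] i j; first by exists (alt i j m).
by have [r rE] := IH j i; exists r; rewrite addSn /= rE.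
Qed.

Lemma alt_rcons i j n :
  alt i j n.+1 = rcons (alt i j n) (if odd n then j else i).
Proof.
elim: n i j => //= n IH i j; rewrite IH.
by rewrite if_neg.
Qed.

Lemma alt_rev i j n : alt j i n ++ rev (alt i j n) = alt j i (n + n).
Proof.
have alt_cat p q : alt j i (p + q) = alt j i p ++ (if odd p then alt i j q else alt j i q).
  elim: p (i) (j) => //= p IH i' j'; rewrite IH.
  by case: (odd p).
rewrite alt_cat; congr (_ ++ _); elim: n i j {alt_cat} => //= n IH i j.
rewrite rev_cons IH.
by case: ifP => on /=; rewrite -/(alt _ _ n.+1) alt_rcons on.
Qed.

(** A nonempty alternating word within the bound inverts its first simple root; if it also inverted
    the other one, it would invert every positive root supported on [K]. So up to that length each
    new letter adds one inversion. [K] is a variable because the induction exchanges [i] and [j]. *)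
Lemma inv_alt (K : {set I}) (i j : I) n a : i \in K -> j \in K -> {subset K <= [set i; j]%SET} ->
  (n <= size (posroots K a))%N -> inv K a (alt i j n) = n.
Proof.
move=> iK jK Kij; move: n => n.
(* The claim is strengthened by the positivity of [alpha j], where [j] is the letter to be prepended
   next. *)
suff : forall (i j : I) a, i \in K -> j \in K -> {subset K <= [set i; j]%SET} ->
    (n <= size (posroots K a))%N ->
    inv K a (alt i j n) = n /\
    (n < size (posroots K a) -> nneg (back a (alt i j n) (alpha j)))%N.
  by move=> h nm; have [] := h i j a.
elim: n => [|n IH] {}i {}j {}a {}iK {}jK {}Kij nm.
  by rewrite inv_nil //; split => // _; apply: nneg_alpha.
have sz : size (posroots K (rho i a)) = size (posroots K a).
  by rewrite -(@size_posroots_src _ _ _ hC K a [:: i]) // => k; rewrite inE => /eqP ->.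
have Kji : {subset K <= [set j; i]%SET} by move=> k /Kij; rewrite !inE orbC.
have [|invn nn] := IH j i (rho i a) jK iK Kji; first by rewrite sz ltnW.
have := inv_cons hC a (alt j i n) iK; rewrite invn nn ?sz // addn0 addn1 /= => e.
split=> // nm'; apply/negPn/negP => neg; move: nm'.
rewrite -e (inv_full hC) ?ltnn // => k /Kij; rewrite !inE => /orP[]/eqP -> //.
rewrite /= sigma_alpha_self backN.
by rewrite (root_nnegN hC (root_back _ (root_alpha _ _ _))) negbK nn ?sz.
Qed.

Lemma alt_nneg (K : {set I}) (i j : I) n a : i \in K -> j \in K -> {subset K <= [set i; j]%SET} ->
  (n < size (posroots K a))%N -> nneg (back a (alt j i n) (alpha i)).
Proof.
move=> iK jK Kij nm.
have Kji : {subset K <= [set j; i]%SET} by move=> k /Kij; rewrite !inE orbC.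
have sz : size (posroots K (rho i a)) = size (posroots K a).
  by rewrite -(@size_posroots_src _ _ _ hC K a [:: i]) // => k; rewrite inE => /eqP ->.
have := inv_cons hC (rho i a) (alt j i n) iK.
rewrite -[i :: _]/(alt i j n.+1) rhoK !inv_alt ?sz //; last exact: ltnW.
by case: (nneg _) => //=; lia.
Qed.

(** Each letter contributes a 2 by 2 block of determinant -1. *)
Lemma back_det i j a s : i != j -> {subset s <= [set i; j]%SET} ->
  back a s (alpha i) i * back a s (alpha j) j -
  back a s (alpha i) j * back a s (alpha j) i = (-1) ^+ size s.
Proof.
move=> ij; elim: s a => [|k s IH] a sK.
  by rewrite !ffunE !eqxx [j == i]eq_sym (negbTE ij) /= mulr0 subr0 mulr1.
have {}IH := IH (rho k a) (subset_tl sK); rewrite /= exprS -IH.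
have := sK k (mem_head _ _); rewrite !inE => /orP[]/eqP ->.
  rewrite sigma_alpha_self sigma_alpha backD !backN backZ.
  rewrite !ffunE !Defs.ffunMzE; ring.
rewrite sigma_alpha_self sigma_alpha backD !backN backZ.
by rewrite !ffunE !Defs.ffunMzE; ring.
Qed.

End Dihedral.

Section Braid.
Variables (I A : finType) (C : cartanScheme I A).
Hypothesis hC : finite_root_system C (real_roots C).
Implicit Types (a b : A) (i j : I) (s t r : seq I) (x y : lattice I).

Notation src := (word_src C).
Notation wmap := (word_map C).
Notation rho := (rho C).
Notation R := (real_roots C).
Notation back := (back C).
Notation eqw := (eqw C).
Notation inv := (inv C).
Notation posroots := (posroots C).

(** Identifies the exponent in (R4) with the length up to which [inv_alt] applies. *)
Lemma card_posroots2 a i j : i != j ->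
  (R a `&` [set x | exists p q : nat, x = alpha i *+ p + alpha j *+ q]
    #= `I_(size (posroots [set i; j]%SET a)))%card.
Proof.
move=> ij; pose F := seq_fset tt (posroots [set i; j]%SET a).
have -> : size (posroots [set i; j]%SET a) = #|` F|.
  by rewrite size_seq_fset undup_id //; apply: uniq_posroots.
suff -> : R a `&` [set x | exists p q : nat, x = alpha i *+ p + alpha j *+ q]
  = [set` F] by apply/card_eq_fsetP.
apply/seteqP; split=> x /=; rewrite seq_fsetE mem_posroots.
  move=> [Rx [p [q xE]]]; apply/and3P; split; last exact/mem_roots.
    apply/nnegP => k; rewrite xE !ffunE !ffunMnE !alphaE.
    by rewrite addr_ge0 // mulrn_wge0 //; case: (_ == _).
  apply/supportedP => k; rewrite !inE negb_or => /andP[/negbTE ki /negbTE kj].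
  by rewrite xE !ffunE !ffunMnE !alphaE ki kj !mul0rn.
move=> /and3P[/nnegP x0 /supportedP xK /mem_roots Rx]; split; first exact: Rx.
exists `|x i|%N, `|x j|%N.
rewrite {1}[x]lattice_sum (bigD1 i) //= (bigD1 j) 1?eq_sym //= big1 ?addr0.
  by rewrite !pmulrn !gez0_abs.
move=> k /andP[ki kj]; rewrite xK ?mulr0z //.
by rewrite !inE negb_or ki.
Qed.

Lemma size_posroots_gt0 (K : {set I}) a i : i \in K -> (0 < size (posroots K a))%N.
Proof.
by move=> iK; rewrite -has_predT; apply/hasP; exists (alpha i) => //; apply: alpha_posroots.
Qed.

Lemma src_alt a i j n : src a (alt j i (n + n)) = iter n (rho i \o rho j) a.
Proof.
elim: n a => //= n IH a; rewrite addnS /= IH -iterSr iterS //.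
Qed.

(** Walking along [alt j i n] and then along the reverse of [alt i j n] is walking along
    [alt j i (n + n)]. If that walk is closed, its two halves end in the same object. *)
Lemma src_alt_eq a i j n : src a (alt j i (n + n)) = a ->
  src a (alt i j n) = src a (alt j i n).
Proof.
rewrite -alt_rev word_src_cat => e.
have := word_src_rev C (src a (alt j i n)) (rev (alt i j n)).
by rewrite e revK.
Qed.

(** Determinant 1 makes [p] and [s] positive. The vanishing sums of nonnegative products then kill
    [q'] and [r'], and after that [q] and [r]. *)
Lemma nneg_mx2_id (p q r s p' q' r' s' : int) :
  0 <= p -> 0 <= q -> 0 <= r -> 0 <= s -> 0 <= p' -> 0 <= q' -> 0 <= r' -> 0 <= s' ->
  p' * p + r' * q = 1 -> q' * p + s' * q = 0 -> p' * r + r' * s = 0 ->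
  q' * r + s' * s = 1 -> p * s - q * r = 1 -> [/\ p = 1, q = 0, r = 0 & s = 1].
Proof.
move=> p0 q0 r0 s0 p0' q0' r0' s0' e1 e2 e3 e4 d.
have pos (a b : int) : 0 <= a -> 0 <= b -> 0 <= a * b by exact: mulr_ge0.
have ps : 0 < p * s by have := pos _ _ q0 r0; lia.
have p_gt0 : 0 < p by case: (ltgtP p 0) ps p0 => // ->; rewrite mul0r.
have s_gt0 : 0 < s by case: (ltgtP s 0) ps s0 => // ->; rewrite mulr0.
have q'z : q' = 0.
  have /eqP : q' * p = 0 by have := pos _ _ q0' p0; have := pos _ _ s0' q0; lia.
  by rewrite mulf_eq0 (gt_eqF p_gt0) orbF => /eqP.
have r'z : r' = 0.
  have /eqP : r' * s = 0 by have := pos _ _ p0' r0; have := pos _ _ r0' s0; lia.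
  by rewrite mulf_eq0 (gt_eqF s_gt0) orbF => /eqP.
move: e1 e2 e3 e4; rewrite q'z r'z !mul0r !add0r !addr0 => e1 /eqP e2 /eqP e3 e4.
have p'_neq0 : p' != 0 by apply: contra_eq_neq e1 => ->; rewrite mul0r.
have s'_neq0 : s' != 0 by apply: contra_eq_neq e4 => ->; rewrite mul0r.
move: e2 e3; rewrite !mulf_eq0 (negbTE p'_neq0) (negbTE s'_neq0) => /eqP q_z /eqP r_z.
by split=> //; nia.
Qed.

(* Rank two nonnegative integer matrices with nonnegative inverse are
   permutation matrices, and the determinant excludes the transposition. *)
Lemma back_id_rank2 i j c s : i != j -> {subset s <= [set i; j]%SET} ->
  ~~ odd (size s) -> src c s = c ->
  (forall k, nneg (back c s (alpha k))) ->
  (forall k, nneg (wmap c s (alpha k))) -> back c s =1 id.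
Proof.
move=> ij sK so sc s0 s'0.
have wE x : wmap c s x = back c (rev s) x by rewrite -back_rev sc.
have rK : {subset rev s <= [set i; j]%SET} by move=> k; rewrite mem_rev => /sK.
have w0 x : nneg x -> nneg (wmap c s x).
  by move=> x0; rewrite wE (@nneg_back _ _ _ _ _ _ [set: I]%SET) // => k; rewrite -?wE ?inE.
have dec x : supported [set i; j]%SET x -> x = alpha i *~ x i + alpha j *~ x j.
  move=> /supportedP xK; rewrite {1}[x]lattice_sum (bigD1 i) //= (bigD1 j) 1?eq_sym //=.
  rewrite big1 ?addr0 // => k /andP[ki kj]; rewrite xK ?mulr0z //.
  by rewrite !inE negb_or ki.
have supp t k : {subset t <= [set i; j]%SET} -> k \in [set i; j]%SET ->
    supported [set i; j]%SET (back c t (alpha k)).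
  move=> tK kK; apply/supportedP => l lK.
  rewrite back_letters; last by apply: contra lK => /tK.
  by rewrite alphaE; case: eqP => // e; rewrite e kK in lK.
have iK : i \in [set i; j]%SET by rewrite !inE eqxx.
have jK : j \in [set i; j]%SET by rewrite !inE eqxx orbT.
have fix2 : back c s (alpha i) = alpha i /\ back c s (alpha j) = alpha j.
  have det := back_det C c ij sK; rewrite -signr_odd (negbTE so) expr0 in det.
  have e1 := backK C c s (alpha i); have e2 := backK C c s (alpha j).
  rewrite wE (dec _ (supp s i sK iK)) backD !backZ in e1.
  rewrite wE (dec _ (supp s j sK jK)) backD !backZ in e2.
  have ev (p q : int) u v x k : u *~ p + v *~ q = x -> u k * p + v k * q = x k.
    by move=> <-; rewrite ffunE !Defs.ffunMzE.
  have := (ev _ _ _ _ _ j e2); have := (ev _ _ _ _ _ i e2).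
  have := (ev _ _ _ _ _ j e1); have := (ev _ _ _ _ _ i e1).
  rewrite !alphaE !eqxx [j == i]eq_sym (negbTE ij) /= => m1 m2 m3 m4.
  have := s0 i; have := s0 j; have := s'0 i; have := s'0 j; rewrite !wE.
  move=> /nnegP j' /nnegP i' /nnegP j0 /nnegP i0.
  have [pE qE rE tE] := nneg_mx2_id (i0 i) (i0 j) (j0 i) (j0 j) (i' i) (i' j)
    (j' i) (j' j) m1 m2 m3 m4 det.
  rewrite [back c s (alpha i)]dec ?supp // [back c s (alpha j)]dec ?supp //.
  by rewrite pE qE rE tE !mulr1z !mulr0z addr0 add0r.
have fixall k : back c s (alpha k) = alpha k.
  have [|kK] := boolP (k \in [set i; j]%SET).
    by case: fix2 => ? ?; rewrite !inE => /orP[]/eqP ->.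
  (* For [k] outside the pair, the word adds a nonnegative [v] to [alpha k] and its inverse adds a
     nonnegative [v']. Composing the two gives [wmap c s v = - v'], which is both nonnegative and
     nonpositive, so [v] vanishes. *)
  pose v := back c s (alpha k) - alpha k.
  pose v' := wmap c s (alpha k) - alpha k.
  have nnv t : {subset t <= [set i; j]%SET} -> nneg (back c t (alpha k)) ->
      nneg (back c t (alpha k) - alpha k).
    move=> tK /nnegP t0; apply/nnegP => l; rewrite !ffunE.
    have [->|_] := eqVneq l k; last by rewrite subr0.
    rewrite back_letters ?ffunE ?eqxx ?subrr //.
    by apply: contra kK => /tK.
  have v0 : nneg v by apply: nnv.
  have v'0 : nneg v' by rewrite /v' wE nnv // -wE.
  have := backK C c s (alpha k); rewrite -[back c s _](subrK (alpha k)) -/v.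
  rewrite wE backD -!wE -[wmap c s (alpha k)](subrK (alpha k)) -/v' addrA.
  move=> /(canRL (addrK _)); rewrite subrr => /eqP; rewrite addr_eq0 => /eqP vv.
  have wv0 : wmap c s v = 0.
    apply: nneg_antisym; first exact: w0.
    by rewrite vv opprK.
  have v_0 : v = 0 by rewrite -[v](word_mapK C c s) wv0 back0.
  by rewrite v_0 add0r.
move=> x; apply/ffunP => l; rewrite back_sum [in RHS](lattice_sum x) sum_ffunE.
by apply: eq_bigr => k _; rewrite fixall Defs.ffunMzE.
Qed.

(** Two full inversions cancel: the root [g] that [s] carries to [alpha l] is supported on [K] and
    must be negative, since [s] inverts all positive ones; [t] then makes it positive. *)
Lemma nneg_back_full (K : {set I}) a s t l : inv K a s = size (posroots K a) ->
  inv K a t = size (posroots K a) -> {subset s <= K} -> l \in K ->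
  nneg (back (src a s) (rev s ++ t) (alpha l)).
Proof.
move=> fs ft sK lK; rewrite back_cat word_src_rev.
set g := back (src a s) (rev s) (alpha l); have Rg : R a g.
  by have := root_back (rev s) (root_alpha C (src a s) l); rewrite word_src_rev.
have gl : back a s g = alpha l by rewrite /g back_rev word_mapK.
have gK : supported K g.
  apply/supportedP => k kK; rewrite /g back_letters.
    by rewrite alphaE; case: eqP => // e; rewrite e lK in kK.
  by rewrite mem_rev; apply: contra kK => /sK.
have [g0|g0] := boolP (nneg g).
  have : g \in posroots K a by rewrite mem_posroots g0 gK; apply/mem_roots.
  by move/(inv_fullP fs); rewrite gl nneg_alpha.
have : - g \in posroots K a.
  rewrite mem_posroots (root_nnegN hC Rg) g0 /=; apply/andP; split.
    by apply/supportedP => k /(supportedP _ _ gK) e; rewrite ffunE e oppr0.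
  by apply/mem_roots => //; apply: root_opp.
by move/(inv_fullP ft); rewrite backN (root_nnegN hC (root_back t Rg)) negbK.
Qed.

(** Both words invert every positive root supported on the pair. The loop [z] formed from them and
    its inverse therefore keep all simple roots positive, so [z] acts as the identity by
    [back_id_rank2]; (R4) is what closes the loop. *)
Lemma braid i j a (m := size (posroots [set i; j]%SET a)) : i != j ->
  eqw a (alt i j m) (alt j i m).
Proof.
move=> ij; set K := [set i; j]%SET.
have iK : i \in K by rewrite !inE eqxx.
have jK : j \in K by rewrite !inE eqxx orbT.
have subij : {subset K <= K} by [].
have subji : {subset K <= [set j; i]%SET} by move=> k; rewrite !inE orbC.
have sij := @alt_letters _ i j m.
have sji : {subset alt j i m <= K} by move=> k /alt_letters; rewrite !inE orbC.
have se : src a (alt i j m) = src a (alt j i m).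
  apply: src_alt_eq; rewrite src_alt; have [[_ _ _ R4] _] := hC.
  exact: R4 ij (card_posroots2 _ ij).
have f1 : inv K a (alt i j m) = m by rewrite (inv_alt hC).
have f2 : inv K a (alt j i m) = m by rewrite (inv_alt hC).
set c := src a (alt i j m); pose z := rev (alt i j m) ++ alt j i m.
have zK : {subset z <= K}.
  by move=> k; rewrite mem_cat mem_rev => /orP[/sij|/sji].
have sz : src c z = c by rewrite /z word_src_cat word_src_rev -se.
have pos s k : {subset s <= K} -> k \notin K -> nneg (back c s (alpha k)).
  move=> sK kK; apply: (@root_nneg_coord _ _ _ hC (src c s) _ k).
    exact/root_back/root_alpha.
  by rewrite back_letters ?alphaE ?eqxx //; apply: contra kK => /sK.
have zid : back c z =1 id.
  apply: (@back_id_rank2 i j) => // [|k|k].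
  - by rewrite size_cat size_rev !size_alt addnn odd_double.
  - have [kK|kK] := boolP (k \in K); last exact: pos.
    exact: (@nneg_back_full K).
  - rewrite -back_rev sz; have [kK|kK] := boolP (k \in K).
      by rewrite rev_cat revK /c se; apply: (@nneg_back_full K).
    by apply: pos => // l; rewrite mem_rev => /zK.
have /eqw_catl/eqw_sym : eqw c z [::] by apply: back_eqw.
rewrite cats0 => e; apply: eqw_trans e _; rewrite /z catA.
exact: (eqw_catr _ (eqw_revr _ _ _)).
Qed.

End Braid.

(** * Length equals the number of inversions *)

Section Reduced.
Variables (I A : finType) (C : cartanScheme I A).
Hypothesis hC : finite_root_system C (real_roots C).
Implicit Types (a b : A) (i j k : I) (s t r v : seq I) (x y : lattice I).

Notation src := (word_src C).
Notation rho := (rho C).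
Notation back := (back C).
Notation eqw := (eqw C).
Notation posroots := (posroots C).

Definition reduced a s := forall t, eqw a s t -> (size s <= size t)%N.

Lemma reduced_exists a s : exists2 t, eqw a s t & reduced a t.
Proof.
have ex : exists n, `[< exists t, eqw a s t /\ size t = n >].
  by exists (size s); apply/asboolP; exists s.
case: (ex_minnP ex) => n /asboolP[t [st tn]] min; exists t => // r tr.
by rewrite tn min //; apply/asboolP; exists r; split=> //; apply: eqw_trans tr.
Qed.

Lemma reduced_eqw a s t : reduced a s -> eqw a s t -> size s = size t -> reduced a t.
Proof. by move=> rs st st' r tr; rewrite -st'; apply/rs/(eqw_trans st). Qed.

Lemma reduced_catl a s t : reduced a (s ++ t) -> reduced a s.
Proof.
move=> rst r sr; have := rst (r ++ t) (eqw_catr t sr).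
by rewrite !size_cat leq_add2r.
Qed.

Lemma reduced_catr a s t : reduced a (s ++ t) -> reduced (src a s) t.
Proof.
move=> rst r tr; have := rst (s ++ r) (eqw_catl tr).
by rewrite !size_cat leq_add2l.
Qed.

Lemma reduced_cons a i s : reduced a (i :: s) -> reduced (rho i a) s.
Proof. exact: (@reduced_catr a [:: i]). Qed.

Lemma not_reduced_ii a i s : ~ reduced a [:: i, i & s].
Proof. by move=> /(_ s (eqw_ii _ _ _ _)); rewrite /= ltnNge leqnSn. Qed.

Lemma eqw_odd a s t : eqw a s t -> odd (size s) = odd (size t).
Proof.
move=> /(inv_eqw [set: I]%SET) e.
by rewrite -!(inv_odd hC (K := [set: I]%SET) a) ?e // => k; rewrite !inE.
Qed.

Lemma reduced_alt a i j s : reduced a s -> {subset s <= [set i; j]%SET} ->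
  s = alt i j (size s) \/ s = alt j i (size s).
Proof.
elim: s a => [|k s IH] a rs sK; first by left.
have {IH} := IH _ (reduced_cons rs) (subset_tl sK).
have := sK k (mem_head _ _); rewrite !inE.
case: s rs {sK} => [|l s] rs; first by move=> /orP[]/eqP ->; [left|right].
by move=> /orP[]/eqP e [] sE; move: rs; rewrite e => rs /=; move: sE => /= sE;
  (try by left; rewrite sE); (try by right; rewrite sE);
  case: sE rs => -> _ /not_reduced_ii.
Qed.

(* As in Humphreys, Reflection groups and Coxeter groups, Theorem 5.4: factor [s]
   through its coset modulo the rank two parabolic of [i] and its first letter,
   apply induction to the minimal representative [v], and reduce to rank two. *)
Lemma reduced_nneg a i s : reduced a s -> reduced (rho i a) (i :: s) ->
  nneg (back a s (alpha i)).
Proof.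
have [n] := ubnP (size s); elim: n => // n IH in a i s * => sn rs ris.
case: s sn rs ris => [|j s] sn rs ris; first exact: nneg_alpha.
have ij : i != j.
  by apply/eqP => ij; move: ris; rewrite -ij => /not_reduced_ii.
set w := j :: s in sn rs ris *; set K := [set i; j]%SET.
pose dec m := exists t v, [/\ {subset t <= K}, eqw a w (t ++ v),
  size w = (size t + size v)%N & size v = m].
have decs : dec (size s).
  by exists [:: j], s; split=> // k; rewrite !inE => ->; rewrite orbT.
have ex : exists m, `[< dec m >] by exists (size s); apply/asboolP.
case: (ex_minnP ex) => m /asboolP[t [v [tK wtv sz vm]]] min.
have ms : (m <= size s)%N by apply/min/asboolP.
have rtv : reduced a (t ++ v) by apply: reduced_eqw rs wtv _; rewrite size_cat.
(* For [l] in [K] the word [l :: v] is reduced as well: otherwise moving [l] into the first factor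
   would leave a second factor shorter than the minimum. *)
have vpos l : l \in K -> nneg (back (src a t) v (alpha l)).
  move=> lK; apply: IH; first by rewrite vm; apply: leq_ltn_trans ms _.
    exact: reduced_catr rtv.
  move=> v' vv' /=; rewrite leqNgt; apply/negP => lt.
  (* [v'] has the same parity as [l :: v], so being shorter means being shorter by at least two. *)
  have lt' : (size v' < size v)%N.
    by have := eqw_odd vv'; rewrite /=; lia.
  have wtv' : eqw a w ((t ++ [:: l]) ++ v').
    apply: eqw_trans wtv _; rewrite -catA; apply: eqw_catl.
    apply: eqw_trans (eqw_sym (eqw_ii C (src a t) l v)) _.
    exact: eqw_cons.
  have szw : size w = (size (t ++ [:: l]) + size v')%N.
    have := rs _ wtv'; rewrite !size_cat sz /=; lia.
  have : (m <= size v')%N.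
    apply/min/asboolP; exists (t ++ [:: l]), v'; split=> // k.
    by rewrite mem_cat inE => /orP[/tK|/eqP ->].
  by rewrite -vm leqNgt lt'.
have rit : reduced (rho i a) (i :: t).
  apply: (@reduced_catl _ _ v); apply: reduced_eqw ris _ _.
    by apply: eqw_cons; rewrite rhoK.
  by rewrite -[LHS]/(size w).+1 sz /= size_cat.
have itK : {subset i :: t <= K}.
  by move=> k; rewrite inE => /orP[/eqP ->|/tK //]; rewrite !inE eqxx.
have tE : t = alt j i (size t).
  have [|[] //] := reduced_alt (reduced_catl rtv) tK.
  case: (t) rit => //= k t' rit' [kE _]; move: rit'; rewrite kE.
  by move=> /not_reduced_ii.
have iK : i \in K by rewrite !inE eqxx.
have jK : j \in K by rewrite !inE eqxx orbT.
(* If [t] reached the length of the braid relation, that relation would rewrite its beginning to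
   start with [i], and [i :: t] would not be reduced. *)
have tm : (size t < size (posroots K a))%N.
  rewrite ltnNge; apply/negP => le.
  have [r tr] := alt_addn j i (size (posroots K a)) (size t - size (posroots K a)).
  move: rit; rewrite tE -(subnKC le) tr -cat_cons => /reduced_catl rm.
  have := size_posroots_gt0 hC a iK; case e : (size _) rm => [//|p] rm _.
  have br := braid hC a ij; rewrite -/K e in br.
  apply: (@not_reduced_ii (rho i a) i (alt j i p)).
  apply: reduced_eqw rm _ _; last by rewrite /= !size_alt.
  by apply: eqw_cons; rewrite rhoK; apply: eqw_sym.
have tnn : nneg (back a t (alpha i)) by rewrite tE (alt_nneg hC iK jK).
rewrite (eqw_back wtv) back_cat.
apply: (@nneg_back _ _ _ _ _ _ K) => // k kK.
rewrite back_letters; last by apply: contra kK => /tK.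
by rewrite alphaE; case: eqP => // e; rewrite e iK in kK.
Qed.

Definition len a s := inv C [set: I]%SET a s.

Lemma reduced_len a s : reduced a s -> len a s = size s.
Proof.
elim: s a => [|i s IH] a rs; first by rewrite /len inv_nil.
have rs' := reduced_cons rs.
have := inv_cons hC a s (finset.in_setT i).
rewrite reduced_nneg ?rhoK // -/(len _ _) -/(len _ _) (IH _ rs') addn0 addn1.
by [].
Qed.

Lemma len_eqw a s t : eqw a s t -> len a s = len a t.
Proof. exact: inv_eqw. Qed.

Lemma len_le a s : (len a s <= size s)%N.
Proof. by apply: inv_bound => // k; rewrite inE. Qed.

Lemma len0 a s : len a s = 0%N -> eqw a s [::].
Proof.
move=> l0; have [t st rt] := reduced_exists a s.
by move: (reduced_len rt); rewrite -(len_eqw st) l0; case: t st {rt}.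
Qed.

Lemma len_cons a i s :
  len a (i :: s) = if nneg (back (rho i a) s (alpha i)) then (len (rho i a) s).+1
                   else (len (rho i a) s).-1.
Proof.
have := inv_cons hC a s (finset.in_setT i); rewrite -!/(len _ _).
by case: (nneg _) => /=; lia.
Qed.

Lemma len_cat a s t : (len a (s ++ t) <= len a s + len (src a s) t)%N.
Proof.
have [s' ss' rs'] := reduced_exists a s; have [t' tt' rt'] := reduced_exists (src a s) t.
have e : eqw a (s ++ t) (s' ++ t').
  apply: eqw_trans (eqw_catr t ss') _.
  by apply: eqw_catl; case: (ss') => <- _; exact: tt'.
rewrite (len_eqw e) (len_eqw ss') (len_eqw tt') (reduced_len rs') (reduced_len rt').
by rewrite -size_cat len_le.
Qed.

(** The inversions of a word and of its inverse live at different objects. The counts agree because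
    reversing a reduced word bounds each by the other. *)
Lemma len_rev a s : len (src a s) (rev s) = len a s.
Proof.
have half b t : (len (src b t) (rev t) <= len b t)%N.
  have [t' tt' rt'] := reduced_exists b t.
  have e : eqw (src b t) (rev t) (rev t').
    have [e1 e2] := tt'; apply: back_eqw; first by rewrite word_src_rev e1 word_src_rev.
    by move=> x; rewrite back_rev e1 back_rev e2.
  by rewrite (len_eqw e) (len_eqw tt') (reduced_len rt') -size_rev len_le.
apply/eqP; rewrite eqn_leq half /=.
by have := half (src a s) (rev s); rewrite word_src_rev revK.
Qed.

End Reduced.

(** * Longest words of parabolic subgroupoids *)

Section Longest.
Variables (I A : finType) (C : cartanScheme I A).
Hypothesis hC : finite_root_system C (real_roots C).
Implicit Types (a b c : A) (i j k : I) (s t r q p : seq I) (x y : lattice I).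
Implicit Types K : {set I}.

Notation src := (word_src C).
Notation wmap := (word_map C).
Notation rho := (rho C).
Notation back := (back C).
Notation eqw := (eqw C).
Notation posroots := (posroots C).
Notation len := (len C).

Lemma len_rcons a s k :
  len a (rcons s k) = if nneg (wmap a s (alpha k)) then (len a s).+1 else (len a s).-1.
Proof.
have sr : src a (rcons s k) = rho k (src a s) by rewrite -cats1 word_src_cat.
by rewrite -(len_rev hC) rev_rcons sr (len_cons hC) rhoK back_rev (len_rev hC).
Qed.

Lemma len1 a i : len a [:: i] = 1%N.
Proof. by rewrite (len_cons hC) nneg_alpha /len inv_nil. Qed.

Lemma len_nneg a s : (forall k, nneg (back a s (alpha k))) -> eqw a s [::].
Proof.
move=> h; apply: (len0 hC); apply/eqP.
rewrite -leqn0 leqNgt -has_count -all_predC; apply/allP => x.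
rewrite mem_posroots /= negbK => /andP[x0 _].
by apply: (@nneg_back _ _ _ _ _ _ [set: I]%SET) => // k; rewrite inE.
Qed.

(** The coordinate at [k] stays equal to 1, and a root with one positive coordinate is positive. *)
Lemma nneg_back_out K a s k : {subset s <= K} -> k \notin K ->
  nneg (back a s (alpha k)).
Proof.
move=> sK kK; apply: (@root_nneg_coord _ _ _ hC (src a s) _ k).
  exact/root_back/root_alpha.
by rewrite back_letters ?alphaE ?eqxx //; apply: contra kK => /sK.
Qed.

Lemma supported_back K a s k : {subset s <= K} -> k \in K ->
  supported K (back a s (alpha k)).
Proof.
move=> sK kK; apply/supportedP => l lK.
rewrite back_letters; last by apply: contra lK => /sK.
by rewrite alphaE; case: eqP => // e; rewrite e kK in lK.
Qed.

(** The description of [I_L] by roots; [left_descents_word] identifies the two. *)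
Definition descents a s : {set I} := [set i | ~~ nneg (back a s (alpha i))]%SET.

Lemma descents_eqw a s t : eqw a s t -> descents a s = descents a t.
Proof. by rewrite /descents => /eqw_back ->. Qed.

Lemma mem_descents a s i : (i \in descents a s) = ~~ nneg (back a s (alpha i)).
Proof. by rewrite inE. Qed.

Lemma len_descent a s i : i \in descents a s ->
  len a s = (len (rho i a) (i :: s)).+1.
Proof.
rewrite mem_descents => di; rewrite (len_cons hC) rhoK (negbTE di) prednK //.
rewrite lt0n; apply/negP => /eqP /(len0 hC) /eqw_back e.
by rewrite e nneg_alpha in di.
Qed.

Lemma descents0 a s : descents a s = finset.set0 -> eqw a s [::].
Proof.
move=> d0; apply: len_nneg => k; apply/negPn.
by rewrite -mem_descents d0 finset.in_set0.
Qed.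

(** Prepending [i] shortens [s], and by subadditivity of [len] it then shortens the product, whose
    length is the sum. *)
Lemma descents_cat a s t : len a (s ++ t) = (len a s + len (src a s) t)%N ->
  descents a s \subset descents a (s ++ t).
Proof.
move=> l; apply/fintype.subsetP => i id; have l' := len_descent id.
rewrite mem_descents; apply/negP => n0.
have := len_cons hC (rho i a) i (s ++ t); rewrite rhoK n0 l l'.
have := len_cat hC (rho i a) (i :: s) t; rewrite /= rhoK; lia.
Qed.

(** A characterization of [w_K] that does not mention the weak order; [longest_wordE] links it to
    [longest]. *)
Definition longest_word K a p := {subset p <= K} /\ K \subset descents a p.

(** Maximality concerns letters appended on the right, descents those on the left. If [back] kept
    [alpha k] positive, the result would be a nonnegative combination of simple roots in [K], and
    [wmap] would send it to a negative vector, not back to [alpha k]. *)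
Lemma longest_word_wmap K a p : {subset p <= K} ->
  (forall k, k \in K -> ~~ nneg (wmap a p (alpha k))) -> longest_word K a p.
Proof.
move=> pK h; split=> //; apply/fintype.subsetP => k kK; rewrite mem_descents.
apply/negP => n0; have : nneg (- wmap a p (back a p (alpha k))).
  rewrite -back_rev; apply: (nneg_backN hC) n0 (supported_back a pK kK) => l lK.
  by rewrite back_rev; apply: h.
by rewrite backK (root_nnegN hC (root_alpha C a k)) nneg_alpha.
Qed.

(** Inversions are bounded by the number of positive roots, so some word in [K] has maximal length,
    and no letter of [K] can be appended to it with a gain. *)
Lemma longest_word_exists K a : exists p, longest_word K a p.
Proof.
pose L n := `[< exists p, {subset p <= K} /\ len a p = n >].
have exL : exists n, L n by exists 0%N; apply/asboolP; exists [::]; rewrite /len inv_nil.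
have Lb n : L n -> (n <= size (posroots [set: I]%SET a))%N.
  by move=> /asboolP[p [_ <-]]; apply: count_size.
case: (ex_maxnP exL Lb) => n /asboolP[p [pK pn]] max; exists p.
apply: longest_word_wmap => // k kK; apply/negP => n0.
have : (n.+1 <= n)%N; last by rewrite ltnn.
apply/max/asboolP; exists (rcons p k); split; last by rewrite len_rcons n0 pn.
by move=> l; rewrite mem_rcons inE => /orP[/eqP ->|/pK].
Qed.

Lemma longest_word_full K a p : longest_word K a p ->
  inv C K a p = size (posroots K a).
Proof.
by move=> [_ /fintype.subsetP pK]; apply: (inv_full hC) => k /pK; rewrite mem_descents.
Qed.

(** [rev p ++ q] keeps the simple roots in [K] positive by [nneg_back_full] and the others by
    [nneg_back_out], so it has no inversion at all. *)
Lemma longest_word_uniq K a p q : longest_word K a p -> longest_word K a q ->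
  eqw a p q.
Proof.
move=> lp lq; have [[pK _] [qK _]] := (lp, lq).
have /len_nneg e : forall k, nneg (back (src a p) (rev p ++ q) (alpha k)).
  move=> k; have [kK|kK] := boolP (k \in K).
    by apply: (nneg_back_full hC _ _ pK kK); apply: longest_word_full.
  apply: (@nneg_back_out K) => // l.
  by rewrite mem_cat mem_rev => /orP[/pK|/qK].
have := eqw_sym (eqw_catl e); rewrite cats0 catA => e'.
exact: eqw_trans e' (eqw_catr q (eqw_revr C a p)).
Qed.

(** Descents in [K] are stripped off one at a time, each lowering the length by one, until none is
    left. *)
Lemma parabolic_factor K a (x : seq I) : exists s q, [/\ {subset s <= K}, eqw a x (s ++ q),
  len a x = (size s + len (src a s) q)%N &
  forall k, k \in K -> nneg (back (src a s) q (alpha k))].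
Proof.
move: {2}(len a x) (erefl (len a x)) => n; elim: n a x => [|n IH] a x lx.
  exists [::], x; split=> // k _.
  by rewrite (eqw_back (len0 hC lx)) nneg_alpha.
have [k /andP[kK kd]|no] := pickP (fun k => (k \in K) && (k \in descents a x)).
  have := len_descent kd; rewrite lx => -[/esym lkx].
  have [s [q [sK xE lE qn]]] := IH _ _ lkx.
  exists (k :: s), q; split=> //=.
  - by move=> l; rewrite inE => /orP[/eqP ->|/sK].
  - exact: eqw_trans (eqw_sym (eqw_ii C a k x)) (eqw_cons xE).
  - by rewrite -lkx lE.
exists [::], x; split=> // k kK; have := no k.
by rewrite kK mem_descents /= => /negbFE.
Qed.

(** In the factorization of [x] the part [s] must already invert every [alpha k] with [k] in [K]:
    otherwise the image is a nonnegative vector supported on [K], which [q] keeps nonnegative, and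
    [k] is no descent of [x]. So [s] spells [w_K]. *)
Lemma longest_word_le K a p (x : seq I) : longest_word K a p -> K \subset descents a x ->
  exists2 q, eqw a x (p ++ q) & len a x = (len a p + len (src a p) q)%N.
Proof.
move=> lp xK; have [s [q [sK xE lE qn]]] := parabolic_factor K a x.
have ls : longest_word K a s.
  split=> //; apply/fintype.subsetP => k kK; rewrite mem_descents; apply/negP => n0.
  have := fintype.subsetP xK k kK; rewrite mem_descents (eqw_back xE) back_cat.
  move=> /negP; apply; apply: nneg_back qn n0 _.
  exact/supportedP/supported_back.
have ps := longest_word_uniq lp ls.
have xpq := eqw_trans xE (eqw_catr q (eqw_sym ps)).
exists q => //; have [e _] := ps.
(* Subadditivity gives one inequality, and [len a s <= size s] the other. *)
have := len_cat hC a p q; rewrite -(len_eqw xpq).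
have := len_le hC a s; rewrite (len_eqw ps) lE e; lia.
Qed.

Lemma descents_longest K a p : longest_word K a p -> descents a p = K.
Proof.
move=> [pK Kd]; apply/eqP; rewrite finset.eqEsubset Kd andbT; apply/fintype.subsetP => i.
by rewrite mem_descents; apply: contraNT; apply: nneg_back_out.
Qed.

End Longest.

(** * Morphisms and the weak order *)

Section Morphisms.
Variables (I A : finType) (C : cartanScheme I A).
Hypothesis hC : finite_root_system C (real_roots C).
Implicit Types (a b c : A) (i j k : I) (s t r q p : seq I) (x y : lattice I).
Implicit Types K : {set I}.

Notation src := (word_src C).
Notation wmap := (word_map C).
Notation rho := (rho C).
Notation eqw := (eqw C).
Notation len := (len C).

Definition word_hom a s : homTo C a := homset (word_mor C a s).

Lemma homset_eq a b b' (f : mor C b a) (g : mor C b' a) :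
  b = b' -> mor_map f = mor_map g -> homset f = homset g.
Proof. by move=> e; subst b' => /mor_eq ->. Qed.

Lemma word_homP a (w : homTo C a) : exists s, w = word_hom a s.
Proof.
case: w => b f; have [s [sb sf]] := mor_word f; exists s.
exact: homset_eq.
Qed.

Lemma word_hom_eq a s t : word_hom a s = word_hom a t <-> eqw a s t.
Proof.
split=> [e|[e1 e2]]; last exact: homset_eq.
split; first exact: (congr1 (fun w : homTo C a => tag w) e).
exact: (congr1 (fun w : homTo C a => mor_map (tagged w)) e).
Qed.

Lemma length_word a b (f : mor C b a) s : is_word C b a f s -> length f = len a s.
Proof.
move=> [sb sf]; rewrite /length; case: ex_minnP => n /asboolP[t [tn [tb tf]]] min.
have st : eqw a s t by split; [rewrite sb|rewrite sf].
rewrite (len_eqw st) (reduced_len hC) // => r [e1 e2]; rewrite tn min //.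
by apply/asboolP; exists r; split=> //; split; rewrite -?e1 -?e2.
Qed.

Lemma weak_leP a s t : weak_le (word_hom a s) (word_hom a t) <->
  exists2 r, eqw a t (s ++ r) & len a t = (len a s + len (src a s) r)%N.
Proof.
have lw b r : length (word_mor C b r) = len b r by apply: length_word.
split=> [[/= w [wE]]|[r [e1 e2] l]].
  have [r rw] := mor_word w; have [r1 r2] := rw.
  rewrite (length_word rw) !lw => l; exists r => //; split.
    by rewrite word_src_cat r1.
  by have := congr1 (@mor_map _ _ _ _ _) wE; rewrite word_map_cat /= r2.
have rw : is_word C (src a t) (src a s) (wmap (src a s) r) r.
  by rewrite /is_word -word_src_cat e1.
exists (Mor (ex_intro _ r rw)); split.
  by apply: mor_eq; rewrite /= e2 word_map_cat.
by rewrite !lw l; congr (_ + _)%N; apply: length_word.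
Qed.

Lemma ldiv_word a s t : ldiv (word_hom a s) (word_hom a t) =
  word_hom (src a s) (rev s ++ t).
Proof.
apply: homset_eq => /=; first by rewrite word_src_cat word_src_rev.
rewrite /mor_inv; case: cid => g /= [fg _].
rewrite word_map_cat word_src_rev -backE; congr (_ \o _); apply/funext => x.
have := congr1 (fun f : mor C a a => mor_map f x) fg => /= gx.
by rewrite -[in RHS]gx word_mapK.
Qed.

Lemma ldiv_cat a s r : ldiv (word_hom a s) (word_hom a (s ++ r)) =
  word_hom (src a s) r.
Proof.
rewrite ldiv_word; apply/word_hom_eq; rewrite catA.
exact: (eqw_catr r (eqw_rev C a s)).
Qed.

Lemma left_descents_word a s : left_descents (word_hom a s) = descents C a s.
Proof.
apply/setP => i; rewrite mem_descents !inE; apply/asboolP/idP.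
  move=> /weak_leP[r e]; rewrite (len1 hC) (len_eqw e) add1n /= => l.
  rewrite (eqw_back e) /= sigma_alpha_self backN.
  rewrite (root_nnegN hC (root_back _ (root_alpha C _ _))) negbK.
  by move: l; rewrite (len_cons hC); case: (nneg _) => // l; lia.
rewrite -mem_descents => id; apply/weak_leP; exists (i :: s).
  exact/eqw_sym/eqw_ii.
by rewrite (len1 hC) (len_descent hC id) add1n.
Qed.

Lemma parabolic_word K a b (f : mor C b a) :
  parabolic K f <-> exists2 s, {subset s <= K} & is_word C b a f s.
Proof.
split=> [h|[s sK [sb sf]] S [S1 Sm Si] Sg].
  pose S b a : set (mor C b a) :=
    [set f | exists2 s, {subset s <= K} & is_word C b a f s].
  apply: (h S); last first.
    move=> j c jK; exists [:: j]; first by move=> k; rewrite inE => /eqP ->.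
    by rewrite /is_word /= rhoK.
  split=> [c|c d e g g' [s sK [s1 s2]] [t tK [t1 t2]]|c d g [s sK [s1 s2]]].
  - by exists [::].
  - exists (s ++ t); first by move=> k; rewrite mem_cat => /orP[/sK|/tK].
    by rewrite /is_word word_src_cat word_map_cat s1 s2 t1 t2.
  - exists (rev s); first by move=> k; rewrite mem_rev => /sK.
    subst c; rewrite /mor_inv; case: cid => g' /= [gg' _].
    split; first by rewrite word_src_rev.
    rewrite -backE; apply/funext => x.
    have := congr1 (fun f : mor C d d => mor_map f x) gg' => /= gx.
    by rewrite -[in LHS]gx -s2 word_mapK.
have Sw c j : j \in K -> S _ _ (word_mor C c [:: j]).
  move=> jK; have Sj := Sg j (rho j c) jK.
  (* The generator available has target [rho j (rho j c)], which equals [c] only propositionally;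
     this is the transport. *)
  suff h d e (g : mor C d e) (g' : mor C d c) : S _ _ g -> e = c ->
      mor_map g = mor_map g' -> S _ _ g'.
    by apply: (h _ _ _ _ Sj); rewrite ?rhoK.
  by move=> Sg' e_c; subst e => /mor_eq <-.
have Swd c t : {subset t <= K} -> S _ _ (word_mor C c t).
  elim: t c => [|j t IH] c tK; first exact: S1.
  have := Sm _ _ _ _ _ (Sw c j (tK _ (mem_head _ _))) (IH (rho j c) (subset_tl tK)).
  by congr (S _ _ _); apply: mor_eq.
subst b; have -> : f = word_mor C a s by apply: mor_eq.
exact: Swd.
Qed.

Lemma parabolic_hom_word K a s : {subset s <= K} ->
  parabolic_hom K (word_hom a s).
Proof. by move=> sK; apply/parabolic_word; exists s. Qed.

Lemma parabolic_homP K a (w : homTo C a) : parabolic_hom K w ->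
  exists2 s, {subset s <= K} & w = word_hom a s.
Proof.
case: w => b f /parabolic_word[s sK [sb sf]]; exists s => //.
exact: homset_eq.
Qed.

(** For a maximal element no letter of [K] can be appended with a gain in length, which is the
    hypothesis of [longest_word_wmap]. Conversely, anything in the parabolic above [p] inherits its
    descents and is again a longest word, so uniqueness applies. *)
Lemma longest_wordE K a p : longest_word C K a p -> longest C K a = word_hom a p.
Proof.
move=> lp; have [pK Kd] := lp.
have max : weak_maximal (@parabolic_hom _ _ C K a) = [set word_hom a p].
  apply/seteqP; split=> [w [/parabolic_homP[s sK ->] max]|_ ->] /=.
    apply/word_hom_eq/(longest_word_uniq hC _ lp)/(longest_word_wmap hC) => // k kK.
    apply/negP => n0; have := len_rcons hC a s k; rewrite n0.
    have /word_hom_eq/(len_eqw) -> : word_hom a (rcons s k) = word_hom a s.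
      apply: max.
        by apply: parabolic_hom_word => l; rewrite mem_rcons inE => /orP[/eqP ->|/sK].
      apply/weak_leP; exists [:: k]; first by rewrite cats1.
      by rewrite (len_rcons hC) n0 (len1 hC) addn1.
    by lia.
  split=> [|x /parabolic_homP[s sK ->] /weak_leP[r sE l]].
    exact: parabolic_hom_word.
  apply/word_hom_eq/(longest_word_uniq hC _ lp); split=> //.
  apply: fintype.subset_trans Kd _; rewrite (descents_eqw sE).
  by apply: (descents_cat hC); rewrite -(len_eqw sE).
rewrite /longest; case: xgetP => [w _ /= wE|no].
  by have : [set word_hom a p] w by rewrite -max wE.
by case: (no (word_hom a p)); rewrite /= max.
Qed.

Lemma weak_le_refl a (u : homTo C a) : weak_le u u.
Proof.
have [s ->] := word_homP u; apply/weak_leP; exists [::]; rewrite ?cats0 //.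
by rewrite /len inv_nil addn0.
Qed.

Lemma weak_le_trans a (v u w : homTo C a) :
  weak_le u v -> weak_le v w -> weak_le u w.
Proof.
have [[s ->] [t ->] [r ->]] := And3 (word_homP u) (word_homP v) (word_homP w).
move=> /weak_leP[q tE lt] /weak_leP[q' rE lr]; apply/weak_leP.
have rE' : eqw a r (s ++ (q ++ q')).
  by apply: eqw_trans rE _; rewrite catA; apply: eqw_catr.
exists (q ++ q') => //.
have [e _] := tE; rewrite word_src_cat in e.
have := len_cat hC a s (q ++ q'); rewrite -(len_eqw rE').
have := len_cat hC (src a s) q q'; rewrite -e; lia.
Qed.

Lemma weak_le_anti a (u v : homTo C a) : weak_le u v -> weak_le v u -> u = v.
Proof.
have [[s ->] [t ->]] := conj (word_homP u) (word_homP v).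
move=> /weak_leP[q tE lt] /weak_leP[q' rE lr]; apply/word_hom_eq/eqw_sym.
apply: eqw_trans tE _.
have lq : len (src a s) q = 0%N by lia.
by have := eqw_catl (len0 hC lq); rewrite cats0.
Qed.

End Morphisms.

(** * The retraction of a weak interval *)

Section Interval.
Variables (I A : finType) (C : cartanScheme I A).
Hypothesis hC : finite_root_system C (real_roots C).
Implicit Types (a b c : A) (i j k : I) (s t r : seq I).
Implicit Types K : {set I}.

Notation src := (word_src C).
Notation eqw := (eqw C).
Notation len := (len C).
Notation word_hom := (word_hom C).

Lemma weak_le_catl a s (q q' : seq I) :
  len a (s ++ q) = (len a s + len (src a s) q)%N ->
  len a (s ++ q') = (len a s + len (src a s) q')%N ->
  weak_le (word_hom a (s ++ q)) (word_hom a (s ++ q')) <->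
  weak_le (word_hom (src a s) q) (word_hom (src a s) q').
Proof.
move=> lq lq'; split=> /(weak_leP hC)[t e l]; apply/(weak_leP hC); exists t.
- by apply: (@eqw_catK _ _ C a s); rewrite catA.
- move: l; rewrite lq lq' word_src_cat; lia.
- by rewrite -catA; apply: eqw_catl.
- by rewrite lq lq' word_src_cat l addnA.
Qed.

Lemma weak_le_descents a s t :
  weak_le (word_hom a s) (word_hom a t) -> descents C a s \subset descents C a t.
Proof.
move=> /(weak_leP hC)[q e l]; rewrite (descents_eqw e).
by apply: (descents_cat hC); rewrite -(len_eqw e).
Qed.

Lemma weak_le_catl_bound a s (q : seq I) r :
  len a (s ++ r) = (len a s + len (src a s) r)%N ->
  weak_le (word_hom (src a s) q) (word_hom (src a s) r) ->
  len a (s ++ q) = (len a s + len (src a s) q)%N.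
Proof.
move=> lr /(weak_leP hC)[t e l].
have := len_cat hC a s q; have := len_cat hC a (s ++ q) t.
have e' : eqw a (s ++ r) ((s ++ q) ++ t) by rewrite -catA; apply: eqw_catl.
rewrite -(len_eqw e') lr l word_src_cat; lia.
Qed.

(** An element below [v] has a reduced word no longer than [v], and there are finitely many such
    words over [I]. *)
Lemma finite_weak_le a (v : homTo C a) : finite_set [set w | weak_le w v].
Proof.
have [t ->] := word_homP v.
pose f (s : (len a t).-bseq I) := word_hom a s.
apply: (@sub_finite_set _ _ (f @` setT)); last exact/finite_image/finite_finset.
move=> w /=; have [s ->] := word_homP w; have [s' ss' rs'] := reduced_exists C a s.
move=> /(weak_leP hC)[q e l].
have sz : (size s' <= len a t)%N.
  by rewrite -(reduced_len hC rs') -(len_eqw ss') l leq_addr.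
by exists (Bseq sz) => //; apply/word_hom_eq/eqw_sym.
Qed.

(* [om K] is [u w_K], and [p |-> om (D p)] is the retraction of the interval
   onto the elements of this form. *)
Lemma weak_interval_retraction a (u v : homTo C a) : weak_le u v ->
  let w := ldiv u v in let J := left_descents w in let P := weak_interval u v in
  exists (D : homTo C a -> {set I}) (om : {set I} -> homTo C a),
  [/\ finite_set P,
      forall p, P p -> [/\ D p \subset J, D p != finset.set0 & weak_le (om (D p)) p],
      forall p q, P p -> P q -> weak_le p q -> D p \subset D q,
      forall K K' : {set I}, K \subset K' -> K' \subset J -> weak_le (om K) (om K')
    & forall K : {set I}, K \subset J -> D (om K) = K] /\
  [/\ w <> longest C J (tag u) -> J != finset.set0 /\
        forall K : {set I}, K \subset J -> K != finset.set0 -> P (om K)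
    & w = longest C J (tag u) ->
        (forall K : {set I}, K \subset J -> K != finset.set0 -> K != J -> P (om K)) /\
        forall p, P p -> D p != J].
Proof.
have [s ->] := word_homP u; have [t ->] := word_homP v.
move=> /(weak_leP hC)[r tE lt] w J P.
have lr : len a (s ++ r) = (len a s + len (src a s) r)%N by rewrite -(len_eqw tE).
pose c := src a s; have /word_hom_eq tE' := tE.
have wE : w = word_hom c r by rewrite /w tE' ldiv_cat.
have JE : J = descents C c r by rewrite /J wE (left_descents_word hC).
have [pp ppP] := choice (fun K => longest_word_exists hC K c).
pose D (p : homTo C a) := left_descents (ldiv (word_hom a s) p).
pose om K := word_hom a (s ++ pp K).
have DE q : D (word_hom a (s ++ q)) = descents C c q.
  by rewrite /D ldiv_cat (left_descents_word hC).
have ppr K : K \subset J -> weak_le (word_hom c (pp K)) (word_hom c r).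
  rewrite JE => /(longest_word_le hC (ppP K))[q e l].
  by apply/(weak_leP hC); exists q.
have ppl K : K \subset J -> len a (s ++ pp K) = (len a s + len c (pp K))%N.
  by move=> /ppr; apply: weak_le_catl_bound.
have PE p : P p -> exists q, [/\ p = word_hom a (s ++ q),
    len a (s ++ q) = (len a s + len c q)%N,
    weak_le (word_hom c q) (word_hom c r),
    ~ eqw c q [::] & ~ eqw c q r].
  move=> [[sp pt] /not_orP[ps pr]]; have [q0 pE] := word_homP p.
  move: sp pt ps pr; rewrite pE tE' => /(weak_leP hC)[q qE lq].
  have /word_hom_eq qE' := qE; rewrite qE' => pt ps pr; exists q.
  have lq' : len a (s ++ q) = (len a s + len c q)%N by rewrite -(len_eqw qE).
  split=> // [|/eqw_catl e|/eqw_catl e].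
  - exact/(weak_le_catl lq' lr).
  - by apply: ps; apply/word_hom_eq; rewrite -[in X in eqw _ _ X](cats0 s).
  - by apply: pr; apply/word_hom_eq.
have omP K : K \subset J -> ~ eqw c (pp K) [::] -> ~ eqw c (pp K) r -> P (om K).
  move=> KJ k0 kr; split.
    split; last by rewrite tE'; apply/(weak_le_catl (ppl K KJ) lr)/ppr.
    by apply/(weak_leP hC); exists (pp K) => //; apply: ppl.
  rewrite tE'; apply/not_orP; split=> /word_hom_eq.
    by rewrite -[X in eqw _ _ X]cats0 => /eqw_catK.
  by move=> /eqw_catK.
have pp0 K : K != finset.set0 -> ~ eqw c (pp K) [::].
  move=> /negP K0 /descents_eqw; rewrite (descents_longest hC (ppP K)) => KE.
  apply: K0; rewrite KE; apply/eqP/setP => k.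
  by rewrite mem_descents nneg_alpha finset.in_set0.
(* If [w] lies below some [w_K] with [K] in [J], comparing descents gives [K = J], and antisymmetry
   gives [w = w_J]. *)
have ppw K : K \subset J -> weak_le (word_hom c r) (word_hom c (pp K)) ->
    w = longest C J c.
  move=> KJ rK; have KJ' : K = J.
    apply/eqP; rewrite finset.eqEsubset KJ JE.
    by have := weak_le_descents rK; rewrite (descents_longest hC (ppP K)).
  rewrite (longest_wordE hC (ppP J)) wE -KJ'.
  by apply: (weak_le_anti hC) => //; apply: ppr.
have Dom K : D (om K) = K by rewrite DE (descents_longest hC (ppP K)).
have pple K q : K \subset descents C c q -> weak_le (word_hom c (pp K)) (word_hom c q).
  move=> /(longest_word_le hC (ppP K))[q' e l].
  by apply/(weak_leP hC); exists q'.
exists D, om; split; split.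
- apply: sub_finite_set (finite_weak_le (word_hom a t)) => p [[_ pt] _]; exact: pt.
- move=> p /PE[q [-> lq qr q0 _]]; rewrite DE; have qJ := weak_le_descents qr.
  rewrite -JE in qJ; split=> //.
    by apply/eqP => /(descents0 hC).
  by apply/(weak_le_catl (ppl _ qJ) lq)/pple.
- move=> p p' /PE[q [-> lq _ _ _]] /PE[q' [-> lq' _ _ _]].
  by rewrite !DE => /(weak_le_catl lq lq')/weak_le_descents.
- move=> K K' KK K'J; have KJ := fintype.subset_trans KK K'J.
  apply/(weak_le_catl (ppl _ KJ) (ppl _ K'J))/pple.
  by rewrite (descents_longest hC (ppP K')).
- by move=> K _; apply: Dom.
- move=> wl; split=> [|K KJ K0].
    (* An empty [J] forces [w] to be the identity, which is the longest element for the empty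
       set. *)
    apply/eqP => J0; apply: wl; rewrite -/c.
    have r0 : eqw c r [::] by apply: (descents0 hC); rewrite -JE.
    apply: (ppw finset.set0); first exact: finset.sub0set.
    have /word_hom_eq -> := r0.
    by apply/(weak_leP hC); exists (pp finset.set0); rewrite ?/len ?inv_nil.
  apply: omP => //; first exact: pp0.
  by move=> /word_hom_eq e; apply/wl/(ppw K) => //; rewrite e; apply: weak_le_refl.
- rewrite (longest_wordE hC (ppP J)) -/c => wl; split=> [K KJ K0 KnJ|p /PE[q]].
    apply: omP => //; first exact: pp0.
    move=> /descents_eqw; rewrite (descents_longest hC (ppP K)) -JE => KE.
    by rewrite KE eqxx in KnJ.
  move=> [-> lq qr _ qnr]; rewrite DE; apply/eqP => qJ; apply: qnr.
  apply/word_hom_eq/(weak_le_anti hC) => //; rewrite -wE wl; apply: pple.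
  by rewrite qJ.
Qed.

End Interval.

(** * Continuous maps into realizations of finite complexes *)

Section Continuity.
Variables (R : realType) (Y : topologicalType).
Implicit Types f g : Y -> R.

Lemma continuous_fct_add f g : continuous f -> continuous g ->
  continuous (fun y => f y + g y).
Proof. by move=> cf cg y; apply: cvgD; [exact: cf|exact: cg]. Qed.

Lemma continuous_fct_opp f : continuous f -> continuous (fun y => - f y).
Proof. by move=> cf y; apply: cvgN; exact: cf. Qed.

Lemma continuous_fct_mul f g : continuous f -> continuous g ->
  continuous (fun y => f y * g y).
Proof. by move=> cf cg y; apply: cvgM; [exact: cf|exact: cg]. Qed.

Lemma continuous_fct_inv f : (forall y, f y != 0) -> continuous f ->
  continuous (fun y => (f y)^-1).
Proof. by move=> f0 cf y; apply: cvgV; [exact: f0|exact: cf]. Qed.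

Lemma continuous_fct_cst (r : R) : continuous (fun _ : Y => r).
Proof. by move=> y; apply: cvg_cst. Qed.

Lemma continuous_fct_min f g : continuous f -> continuous g ->
  continuous (fun y => Num.min (f y) (g y)).
Proof. exact: min_fun_continuous. Qed.

Lemma continuous_fct_max f g : continuous f -> continuous g ->
  continuous (fun y => Num.max (f y) (g y)).
Proof. exact: max_fun_continuous. Qed.

(** The default value may vary with [y], as it does in [gap], [maxv] and [minv]. *)
Lemma continuous_fct_big (op : R -> R -> R) (idx : Y -> R) (S : Type) (s : seq S)
    (P : pred S) (F : S -> Y -> R) :
  (forall f g, continuous f -> continuous g -> continuous (fun y => op (f y) (g y))) ->
  continuous idx -> (forall i, P i -> continuous (F i)) ->
  continuous (fun y => \big[op/idx y]_(i <- s | P i) F i y).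
Proof.
move=> cop cidx cF; elim: s => [|i s IH].
  by rewrite (_ : (fun _ => _) = idx) //; apply/funext => y; rewrite big_nil.
have [Pi|nPi] := boolP (P i).
  rewrite (_ : (fun _ => _) = fun y => op (F i y) (\big[op/idx y]_(i <- s | P i) F i y)).
    by apply: cop => //; exact: cF.
  by apply/funext => y; rewrite big_cons Pi.
rewrite (_ : (fun _ => _) = fun y => \big[op/idx y]_(i <- s | P i) F i y) //.
by apply/funext => y; rewrite big_cons (negbTE nPi).
Qed.

Lemma continuous_fct_sum (S : Type) (s : seq S) (P : pred S) (F : S -> Y -> R) :
  (forall i, P i -> continuous (F i)) ->
  continuous (fun y => \sum_(i <- s | P i) F i y).
Proof.
move=> cF; apply: (@continuous_fct_big +%R (fun=> 0)) => //.
  exact: continuous_fct_add.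
exact: continuous_fct_cst.
Qed.

Lemma continuous_ptws (T : Type) (f : Y -> {ptws T -> R}) :
  (forall t, continuous (fun y => f y t)) -> continuous f.
Proof.
move=> cf y; apply/cvg_sup => t; move: y.
apply/(@continuousP _ (initial_topology (@^~ t))) => B [W oW <-].
by apply: open_comp oW => y _; exact: cf.
Qed.

Lemma continuous_mx m n (f : Y -> 'M[R]_(m, n)) :
  (forall i j, continuous (fun y => f y i j)) -> continuous f.
Proof.
move=> cf y; apply/cvg_mx_entourageP => B entB.
apply: filter_forall => i; apply: filter_forall => j.
have /cvg_entourageP/(_ B entB) fB := cf i j y.
suff : nbhs y [set z | (f y i j, f z i j) \in B] by [].
apply: (@filterS _ (nbhs y) _ [set z | B (f y i j, f z i j)]); last exact: fB.
by move=> z; exact: mem_set.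
Qed.

Lemma continuous_set_type (X : topologicalType) (B : set X) (f : Y -> B) :
  continuous (fun y => set_val (f y)) -> continuous f.
Proof. exact: continuous_comp_initial. Qed.

End Continuity.

Section RealizationTopology.
Variables (R : realType) (T : choiceType) (K : set {fset T}).
Notation X := (realization R K).

Lemma point_eq (x y : X) : Defs.coord x = Defs.coord y -> x = y.
Proof.
case: x y => [x x0 xs] [y y0 ys] /= e; subst y.
by congr Point; exact: Prop_irrelevance.
Qed.

Lemma realization_coord_continuous t : continuous (fun x : X => x t).
Proof.
apply/continuousP => V oV.
suff : realization_open ((fun x : X => x t) @^-1` V) by [].
move=> s Ks; exists ((fun f : {ptws T -> R} => f t) @^-1` V).
split; last by [].
by apply: open_comp oV => f _; exact: (@proj_continuous _ (fun=> R) t).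
Qed.

Lemma closed_simplex_coords (s : {fset T}) :
  closed ([set f | [/\ forall t, 0 <= f t, forall t, t \notin s -> f t = 0 &
    \sum_(t <- s) f t = 1]] : set {ptws T -> R}).
Proof.
have cp t : continuous (fun f : {ptws T -> R} => f t).
  exact: (@proj_continuous _ (fun=> R) t).
have -> : [set f | [/\ forall t, 0 <= f t, forall t, t \notin s -> f t = 0 &
    \sum_(t <- s) f t = 1]] =
  (\bigcap_t [set f | 0 <= f t]) `&` (\bigcap_(t in [set t | t \notin s]) [set f | f t = 0])
   `&` [set f | \sum_(t <- s) f t = 1] :> set {ptws T -> R}.
  apply/seteqP; split=> f /=.
    by move=> [h1 h2 h3]; split=> //; split=> t ? /=; [exact: h1|exact: h2].
  by move=> [[h1 h2] h3]; split=> [t|t ts|]; [exact: h1|exact: h2|exact: h3].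
have cl (g : {ptws T -> R} -> R) (B : set R) :
    continuous g -> closed B -> closed (g @^-1` B).
  by move=> cg; apply: preimage_closed => f _; exact: cg.
apply: closedI; first apply: closedI.
- by apply: closed_bigI => t _; exact: (cl _ [set r | 0 <= r] (cp t) (@closed_ge _ 0)).
- by apply: closed_bigI => t _; exact: (cl _ [set r | r = 0] (cp t) (@closed_eq _ 0)).
apply: (cl (fun f => \sum_(t <- s) f t) [set r | r = 1]); last exact: closed_eq.
by apply: continuous_fct_sum => t _; exact: cp.
Qed.

(* For finitely many simplices the coherent topology is the subspace topology. *)
Lemma realization_open_finite (U : set X) : finite_set K -> open U ->
  exists2 W : set {ptws T -> R}, open W & U = [set x : X | W (x : T -> R)].
Proof.
move=> finK oU.
have /choice[W WP] : forall s, exists W : set {ptws T -> R}, K s ->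
    open W /\ closed_simplex s `&` U =
    closed_simplex s `&` [set x : X | W (x : T -> R)].
  move=> s; have [Ks|nKs] := pselect (K s); last by exists setT.
  by have [W oW] := oU s Ks; exists W.
pose S (s : {fset T}) := [set f | [/\ forall t, 0 <= f t, forall t, t \notin s -> f t = 0 &
  \sum_(t <- s) f t = 1]] : set {ptws T -> R}.
exists (~` \bigcup_(s in K) (S s `&` ~` W s)).
  apply/closed_openC/closed_bigcup => // s Ks.
  apply: closedI; first exact: closed_simplex_coords.
  by apply: open_closedC; have [] := WP s Ks.
apply/seteqP; split=> x /=.
  move=> Ux [s Ks [[_ sx _] nWx]]; apply: nWx; have [_ e] := WP s Ks.
  by have : (closed_simplex s `&` U) x by []; rewrite e => -[].
move=> nx; have [s [Ks sx s1]] := coord_simplex x; have [_ e] := WP s Ks.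
suff : (closed_simplex s `&` U) x by case.
rewrite e; split=> //=; apply: contrapT => nW; apply: nx; exists s => //; split=> //.
by split=> // t; apply: coord_ge0.
Qed.

Lemma continuous_realization (Y : topologicalType) (g : Y -> X) :
  finite_set K -> (forall t, continuous (fun y => g y t)) -> continuous g.
Proof.
move=> finK cg; apply/continuousP => U /(realization_open_finite finK)[W oW ->].
rewrite -[_ @^-1` _]/((fun y => (g y : T -> R)) @^-1` W).
apply: (@open_comp _ {ptws T -> R}) oW => y _.
exact: (@continuous_ptws R Y T (fun y => g y : T -> R)).
Qed.

End RealizationTopology.

(** * Points of order complexes *)

Section OrderComplex.
Variables (R : realType) (T : choiceType) (le : T -> T -> Prop) (P : set T).
Hypothesis finP : finite_set P.
Notation K := (order_complex le P).
Notation X := (realization R K).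
Notation PF := (fset_set P).

Lemma in_PF t : reflect (P t) (t \in PF).
Proof. by rewrite in_fset_set //; apply/(iffP idP) => [/set_mem|/mem_set]. Qed.

Lemma PFP (p : PF) : P (val p).
Proof. exact/in_PF/valP. Qed.

Lemma finite_order_complex : finite_set K.
Proof.
apply: sub_finite_set (finite_fset (fpowerset PF)) => s [_ sP _] /=.
by rewrite fpowersetE; apply/fsubsetP => t ts; apply/in_PF/sP.
Qed.

Lemma point_supp (x : X) t : x t != 0 -> P t.
Proof.
have [s [[_ sP _] sx _]] := coord_simplex x => xt; apply: sP => /=.
by apply: contraNT xt => /sx ->.
Qed.

Lemma point_chain (x : X) t t' : x t != 0 -> x t' != 0 -> le t t' \/ le t' t.
Proof.
have [s [[_ _ tot] sx _]] := coord_simplex x => xt xt'; apply: tot => /=.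
  by apply: contraNT xt => /sx ->.
by apply: contraNT xt' => /sx ->.
Qed.

Lemma point_sum (x : X) : \sum_(p : PF) x (val p) = 1.
Proof.
have [s [[_ sP _] sx <-]] := coord_simplex x; symmetry.
transitivity (\sum_(t <- PF) x t); last by rewrite big_seq_fsetE.
apply: big_fset_incl => [|t _ /sx //].
by apply/fsubsetP => t ts; apply/in_PF/sP.
Qed.

Lemma pointE (x : X) t : x t = \sum_(p : PF) x (val p) * (val p == t)%:R.
Proof.
have [tP|tP] := boolP (t \in PF).
  rewrite (bigD1 [` tP]%fset) //= eqxx mulr1 big1 ?addr0 // => p pt.
  rewrite (_ : _ == _ = false) ?mulr0 //; apply: contraNF pt => /eqP e.
  exact/eqP/val_inj.
rewrite big1 => [|p _]; last first.
  rewrite (_ : _ == _ = false) ?mulr0 //; apply: contraNF tP => /eqP <-.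
  exact: valP.
by apply/eqP/negPn/negP => /point_supp/in_PF; rewrite (negbTE tP).
Qed.

(** Convex combinations indexed by an auxiliary type: [h] need not be injective, so masses arriving
    at one vertex from several sources can be tracked separately. *)
Definition simplicial_weights (S : finType) (h : S -> T) (mu : S -> R) :=
  [/\ forall i, 0 <= mu i, \sum_i mu i = 1, forall i, mu i != 0 -> P (h i)
    & forall i j, mu i != 0 -> mu j != 0 -> le (h i) (h j) \/ le (h j) (h i)].

(** The pushforward of the measure [mu] along [h]. *)
Definition push (S : finType) (h : S -> T) (mu : S -> R) t :=
  \sum_i mu i * (h i == t)%:R.

Lemma push_eq0 (S : finType) (h : S -> T) (mu : S -> R) t :
  (forall i, mu i != 0 -> h i != t) -> push h mu t = 0.
Proof.
move=> ht; rewrite /push big1 // => i _; have [->|/ht/negbTE ->] := eqVneq (mu i) 0.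
  by rewrite mul0r.
by rewrite mulr0.
Qed.

Lemma sum_push (S : finType) (h : S -> T) (mu : S -> R) (G : T -> R) (s : {fset T}) :
  (forall i, mu i != 0 -> h i \in s) ->
  \sum_(t <- s) push h mu t * G t = \sum_i mu i * G (h i).
Proof.
move=> hs; under eq_bigr do rewrite mulr_suml.
rewrite exchange_big /=; apply: eq_bigr => i _.
have [->|/hs his] := eqVneq (mu i) 0; first by rewrite mul0r big1 // => t; rewrite !mul0r.
rewrite (big_fsetD1 _ his) /= eqxx mulr1 big_seq big1 ?addr0 // => t.
rewrite !inE => /andP[th _]; rewrite eq_sym (negbTE th) mulr0 mul0r //.
Qed.

Lemma weights_point (S : finType) (h : S -> T) (mu : S -> R) :
  simplicial_weights h mu -> exists x : X, forall t, x t = push h mu t.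
Proof.
move=> [mu0 mu1 muP muC]; pose s := [fset h i | i in S & mu i != 0]%fset.
have hs i : mu i != 0 -> h i \in s.
  by move=> mui; apply/imfsetP; exists i => //=; rewrite inE.
have sum1 : \sum_(t <- s) push h mu t = 1.
  under eq_bigr do rewrite -[push _ _ _]mulr1.
  by rewrite (@sum_push _ _ _ (fun=> 1)) //; under eq_bigr do rewrite mulr1.
have sP t : t \in s -> exists2 i, mu i != 0 & t = h i.
  by move=> /imfsetP[i /=]; rewrite inE => mui ->; exists i.
have ge0 t : 0 <= push h mu t.
  by apply: sumr_ge0 => i _; rewrite mulr_ge0 ?ler0n.
have simp : exists s, [/\ K s, forall t, t \notin s -> push h mu t = 0
                               & \sum_(t <- s) push h mu t = 1].
  exists s; split=> // [|t ts].
    split.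
    - apply/eqP => s0; move: sum1; rewrite s0 big_seq_fset0 => /eqP.
      by rewrite eq_sym oner_eq0.
    - by move=> t /= /sP[i mui ->]; exact: muP.
    - by move=> t t' /= /sP[i mui ->] /sP[j muj ->]; exact: muC.
  apply: push_eq0 => i mui; apply: contraNneq ts => <-; exact: hs.
by exists (Point ge0 simp).
Qed.

Lemma weights_map (Y : topologicalType) (S : finType) (h : S -> T)
    (mu : Y -> S -> R) :
  (forall y, simplicial_weights h (mu y)) ->
  (forall i, continuous (fun y => mu y i)) ->
  exists2 g : Y -> X, continuous g & forall y t, g y t = push h (mu y) t.
Proof.
move=> wmu cmu; have [g gE] := choice (fun y => weights_point (wmu y)).
exists g => //; apply: continuous_realization; first exact: finite_order_complex.
move=> t; rewrite (_ : (fun _ => _) = fun y => push h (mu y) t); last exact/funext.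
apply: continuous_fct_sum => i _; apply: continuous_fct_mul => //.
exact: continuous_fct_cst.
Qed.

Lemma mean_push (S : finType) (h : S -> T) (mu : S -> R) (G : T -> R) :
  (forall i, mu i != 0 -> P (h i)) -> 
  \sum_(p : PF) push h mu (val p) * G (val p) = \sum_i mu i * G (h i).
Proof.
move=> muP; rewrite -(@sum_push _ _ _ _ PF) ?big_seq_fsetE // => i /muP.
by move=> /in_PF.
Qed.

End OrderComplex.

(** * The deformation along a decreasing retraction *)

Section Prism.
Variables (R : realType) (T : choiceType) (le : T -> T -> Prop) (P : set T).
Hypothesis finP : finite_set P.
Hypothesis leR : forall p, le p p.
Hypothesis leT : forall q p r, le p q -> le q r -> le p r.
Hypothesis leA : forall p q, le p q -> le q p -> p = q.
Notation K := (order_complex le P).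
Notation X := (realization R K).
Notation PF := (fset_set P).

Variable f : T -> T.
Hypothesis fP : forall p, P p -> P (f p).
Hypothesis f_le : forall p, P p -> le (f p) p.
Hypothesis f_mono : forall p q, P p -> P q -> le p q -> le (f p) (f q).

Definition below (p q : T) := `[< le q p >] && (q != p).

Definition cumul (x : X) (p : T) : R := \sum_(q : PF | below p (val q)) x (val q).

(* Stacking the coordinates of [x] along its chain as consecutive intervals of
   [[0, 1]], [moved x tau p] is the length of the part of the interval of [p]
   that lies below the level [tau]. *)
Definition moved (x : X) (tau : R) (p : T) : R :=
  Num.min (x p) (Num.max 0 (tau - cumul x p)).

Lemma moved_ge0 x tau p : 0 <= moved x tau p.
Proof. by rewrite /moved le_min coord_ge0 le_max lexx. Qed.

Lemma moved_le x tau p : moved x tau p <= x p.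
Proof. by rewrite /moved ge_min lexx. Qed.

Lemma cumul_ge0 x p : 0 <= cumul x p.
Proof. by apply: sumr_ge0 => q _; exact: coord_ge0. Qed.

Lemma moved0 x tau p : tau <= 0 -> moved x tau p = 0.
Proof.
move=> tau0; rewrite /moved (max_idPl _) ?(min_idPr _) ?coord_ge0 //.
by rewrite subr_le0 (le_trans tau0) // cumul_ge0.
Qed.

Lemma cumul_step x p q : P p -> le p q -> p != q -> cumul x p + x p <= cumul x q.
Proof.
move=> /(in_PF finP) pP pq npq; rewrite /cumul [leRHS](bigD1 [` pP]%fset) /=; last first.
  by rewrite /below npq andbT; apply/asboolP.
rewrite [leRHS]addrC lerD2r [leLHS]big_mkcond [leRHS]big_mkcond ler_sum // => r _.
case: ifP => [/andP[/asboolP rp nrp]|_]; last by case: ifP => // _; exact: coord_ge0.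
rewrite ifT //; apply/andP; split; last first.
  by apply: contra nrp => /eqP ->.
apply/andP; split; first by apply/asboolP/(leT rp).
by apply/eqP => rq; case/eqP: npq; apply: leA => //; rewrite -rq.
Qed.

Lemma cumul_bound x p : P p -> cumul x p + x p <= 1.
Proof.
move=> /(in_PF finP) pP; rewrite -(point_sum finP x) (bigD1 [` pP]%fset) //=.
rewrite [leRHS]addrC lerD2r /cumul [leLHS]big_mkcond [leRHS]big_mkcond ler_sum // => r _.
case: ifP => [/andP[_ nrp]|_]; last by case: ifP => // _; exact: coord_ge0.
by rewrite ifT //; apply: contra nrp => /eqP ->.
Qed.

Lemma moved1 x tau p : 1 <= tau -> moved x tau p = x p.
Proof.
move=> tau1; have [x0|xp] := eqVneq (x p) 0.
  by apply/eqP; rewrite eq_le moved_le x0 moved_ge0.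
rewrite /moved; apply/min_idPl; rewrite le_max; apply/orP; right.
have := cumul_bound x (point_supp xp); lra.
Qed.

(** Moved mass at [q] puts [tau] beyond the start of the interval of [q]; unmoved mass at [p] puts
    [tau] before the end of that of [p]. Hence [p] is not strictly below [q]. *)
Lemma moved_order x tau p q : moved x tau q != 0 -> x p - moved x tau p != 0 ->
  le q p.
Proof.
move=> mq mp.
have xq : x q != 0.
  apply: contra_neq mq => xq; apply/eqP; rewrite eq_le moved_ge0.
  by rewrite -xq moved_le.
have xp : x p != 0.
  apply: contra_neq mp => xp; apply/eqP; rewrite eq_le subr_ge0 moved_le.
  by rewrite xp add0r oppr_le0 moved_ge0.
have [//|pq] := point_chain xq xp; have [e|npq] := eqVneq p q; first by rewrite -e in pq *.
exfalso; have st := cumul_step x (point_supp xp) pq npq.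
have tq : cumul x q < tau.
  rewrite ltNge; apply: contra mq => tq; rewrite /moved (max_idPl _) ?subr_le0 //.
  by rewrite (min_idPr _) // coord_ge0.
case/eqP: mp; rewrite /moved (min_idPl _) ?subrr // le_max; apply/orP; right.
by move: st tq; lra.
Qed.

(** The index [(p, true)] carries the mass of [p] already sent to [f p], and [(p, false)] what is
    left at [p]. *)
Definition prism (y : X * R) (i : PF * bool) : R :=
  if i.2 then moved y.1 y.2 (val i.1) else y.1 (val i.1) - moved y.1 y.2 (val i.1).

Definition prism_vertex (i : PF * bool) : T := if i.2 then f (val i.1) else val i.1.

Lemma prism_sum y (G : T -> R) : \sum_i prism y i * G (prism_vertex i) =
  \sum_(p : PF) (moved y.1 y.2 (val p) * G (f (val p)) +
     (y.1 (val p) - moved y.1 y.2 (val p)) * G (val p)).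
Proof.
rewrite -(pair_bigA _ (fun p b => prism y (p, b) * G (prism_vertex (p, b)))) /=.
by apply: eq_bigr => p _; rewrite big_bool.
Qed.

(** The mixed case is the delicate one: with moved mass of [p] at [f p] and unmoved mass of [q] at
    [q], [moved_order] gives [p <= q], hence [f p <= p <= q]. *)
Lemma prism_weights y : simplicial_weights le P prism_vertex (prism y).
Proof.
have supp p b : prism y (p, b) != 0 -> y.1 (val p) != 0.
  apply: contra_neq => y0; have m0 : moved y.1 y.2 (val p) = 0.
    by apply/eqP; rewrite eq_le moved_ge0 -y0 moved_le.
  by rewrite /prism /= m0 y0 subr0 if_same.
split.
- by move=> [p []]; rewrite /prism /= ?moved_ge0 ?subr_ge0 ?moved_le.
- under eq_bigr do rewrite -[prism _ _]mulr1.
  rewrite (prism_sum y (fun=> 1)) -[RHS](point_sum finP y.1).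
  by apply: eq_bigr => p _; rewrite !mulr1 addrC subrK.
- move=> [p b] _; rewrite /prism_vertex /=.
  by case: b; [apply: fP|]; exact: PFP.
move=> [p b] [q b'] pi qj.
have [xp xq] := (supp _ _ pi, supp _ _ qj).
have [pP qP] := (point_supp xp, point_supp xq).
have pq := point_chain xp xq; move: pi qj; rewrite /prism /prism_vertex /=.
case: b; case: b' => //.
- by move=> _ _; case: pq => pq; [left|right]; exact: f_mono.
- move=> mp mq; left; apply: (leT (q := val p)); first exact: f_le.
  exact: moved_order mp mq.
- move=> mp mq; right; apply: (leT (q := val q)); first exact: f_le.
  exact: moved_order mq mp.
Qed.

Lemma prism_continuous (Y : topologicalType) (x : Y -> X) (tau : Y -> R) i :
  continuous x -> continuous tau ->
  continuous (fun y => prism (x y, tau y) i).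
Proof.
move=> cx ctau.
have cc t : continuous (fun y => x y t).
  by move=> y; apply: (@continuous_comp _ _ _ x (fun z : X => z t));
     [exact: cx|exact: realization_coord_continuous].
have cm p : continuous (fun y => moved (x y) (tau y) p).
  apply: continuous_fct_min; first exact: cc.
  apply: continuous_fct_max; first exact: continuous_fct_cst.
  apply: continuous_fct_add => //; apply: continuous_fct_opp.
  by apply: continuous_fct_sum => q _; exact: cc.
case: i => p []; rewrite /prism /=; first exact: cm.
by apply: continuous_fct_add; [exact: cc|apply: continuous_fct_opp; exact: cm].
Qed.

Lemma prism0 x tau t : tau <= 0 -> push prism_vertex (prism (x, tau)) t = x t.
Proof.
move=> tau0; rewrite /push (prism_sum _ (fun p => (p == t)%:R)) (pointE finP x).
by apply: eq_bigr => p _ /=; rewrite moved0 // mul0r add0r subr0.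
Qed.

Lemma prism1 x tau t : 1 <= tau -> push prism_vertex (prism (x, tau)) t =
  push (f \o val) (fun p : PF => x (val p)) t.
Proof.
move=> tau1; rewrite /push (prism_sum _ (fun p => (p == t)%:R)).
by apply: eq_bigr => p _ /=; rewrite moved1 // subrr mul0r addr0.
Qed.

Lemma retraction_homotopic (g : X -> X) :
  (forall x t, g x t = push (f \o val) (fun p : PF => x (val p)) t) ->
  homotopic R g idfun.
Proof.
move=> gE; have fst_c : continuous (fst : X * R -> X) by move=> y; apply: cvg_fst.
have snd_c : continuous (snd : X * R -> R) by move=> y; apply: cvg_snd.
(* The level is one minus the time, since the homotopy starts at [g], where all mass has been
   moved. *)
have [H cH HE] := weights_map finP (fun y : X * R => prism_weights (y.1, 1 - y.2))
  (fun i => prism_continuous (i := i) fst_c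
    (continuous_fct_add (@continuous_fct_cst R _ 1) (continuous_fct_opp snd_c))).
exists H; split; first exact: continuous_subspaceT.
- by move=> x; apply/point_eq/funext => t; rewrite HE gE prism1 //= subr0.
- by move=> x; apply/point_eq/funext => t; rewrite HE prism0 //= subrr.
Qed.

(** As maps of [P], the identity lies above [f], and [f] lies below the constant [m]. The two
    comparisons give the two halves of the homotopy. *)
Lemma contractible_above (m : T) : P m -> (forall p, P p -> le (f p) m) ->
  contractible R X.
Proof.
move=> mP fm; have [x0 x0E] : exists x0 : X, forall t, x0 t = (m == t)%:R.
  have [|x0 x0E] := @weights_point R T le P unit (fun=> m) (fun=> 1).
    split=> // [|_ _ _ _]; first by rewrite big_const card_unit /= addr0.
    by left; exact: leR.
  exists x0 => t; rewrite x0E /push big_const card_unit /= addr0 mul1r //.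
exists x0.
(* The prism runs at double speed until time 1/2; only then does [s] become positive and pull the
   mass, now all at points [f p <= m], straight to [m]. The clamping keeps the weights valid at
   every real time. *)
pose s (y : X * R) : R := Num.max 0 (Num.min 1 (2 * y.2 - 1)).
have s01 y : 0 <= s y <= 1.
  by rewrite /s le_max lexx /= ge_max ler01 ge_min lexx.
pose mu (y : X * R) (i : PF * bool + unit) : R :=
  if i is inl i' then (1 - s y) * prism (y.1, 2 * y.2) i' else s y.
pose h (i : PF * bool + unit) := if i is inl i' then prism_vertex i' else m.
have wmu y : simplicial_weights le P h (mu y).
  have /andP[s0 s1] := s01 y.
  have [p0 p1 pP pC] := prism_weights (y.1, 2 * y.2).
  have mf i : s y != 0 -> mu y (inl i) != 0 -> le (h (inl i)) m.
    move=> sy; have tau1 : 1 <= 2 * y.2.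
      rewrite leNgt; apply: contra sy => tau1; rewrite /s (max_idPl _) // ge_min.
      by apply/orP; right; rewrite subr_le0 ltW.
    rewrite /mu /h /prism_vertex; case: i => p [] /= mi.
      exact: fm (PFP finP p).
    by move: mi; rewrite /prism /= moved1 // subrr mulr0 eqxx.
  split.
  - by move=> [i|_] //=; rewrite mulr_ge0 // subr_ge0.
  - rewrite big_sumType /= -mulr_sumr p1 mulr1 big_const card_unit /= addr0.
    by rewrite subrK.
  - by move=> [i|_] //=; rewrite mulf_eq0 negb_or => /andP[_ /pP].
  move=> [i|[]] [j|[]] //.
  - by rewrite /= !mulf_eq0 !negb_or => /andP[_ pi] /andP[_ pj]; exact: pC.
  - by move=> mi sy; left; exact: mf.
  - by move=> sy mi; right; exact: mf.
  - by left; exact: leR.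
have fst_c : continuous (fst : X * R -> X) by move=> y; apply: cvg_fst.
have snd_c : continuous (snd : X * R -> R) by move=> y; apply: cvg_snd.
have snd2_c : continuous (fun y : X * R => 2 * y.2).
  by apply: continuous_fct_mul => //; exact: continuous_fct_cst.
have s_c : continuous s.
  apply: continuous_fct_max; first exact: continuous_fct_cst.
  apply: continuous_fct_min; first exact: continuous_fct_cst.
  by apply: continuous_fct_add => //; exact: continuous_fct_cst.
have mu_c i : continuous (fun y => mu y i).
  case: i => [i|_] //=; apply: continuous_fct_mul; last exact: prism_continuous.
  apply: continuous_fct_add; first exact: continuous_fct_cst.
  exact: continuous_fct_opp.
have [H cH HE] := weights_map finP wmu mu_c.
have pushE y t : push h (mu y) t =
    (1 - s y) * push prism_vertex (prism (y.1, 2 * y.2)) t + s y * (m == t)%:R.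
  rewrite /push big_sumType /= big_const card_unit /= addr0 mulr_sumr.
  by congr (_ + _); apply: eq_bigr => i _; rewrite mulrA.
exists H; split; first exact: continuous_subspaceT.
- move=> x; apply/point_eq/funext => t; rewrite HE pushE /= mulr0 prism0 //.
  by rewrite /s /= mulr0 sub0r (min_idPr _) ?(max_idPl _) ?subr0 ?mul1r ?mul0r ?addr0 //; lra.
- move=> x; apply/point_eq/funext => t; rewrite HE pushE x0E.
  have -> : s (x, 1) = 1.
    by rewrite /s /= mulr1 (_ : 2 - 1 = 1) ?minxx ?(max_idPr _) ?ler01 //; lra.
  by rewrite subrr mul0r add0r mul1r.
Qed.

End Prism.

(** * Gaps of a real function *)

Section Gap.
Variables (R : realType) (n : nat).
Notation Q := 'I_n.+1.
Implicit Types (z : Q -> R) (L : {set Q}).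

Definition maxv z : R := \big[Num.max/z ord0]_q z q.
Definition minv z : R := \big[Num.min/z ord0]_q z q.

(* The default values make the gap vanish for [L] empty or full. *)
Definition gap z L : R :=
  Num.max 0 (\big[Num.min/maxv z]_(k in L) z k -
             \big[Num.max/minv z]_(l | l \notin L) z l).

Lemma neq_setTP L : reflect (exists l, l \notin L) (L != [set: Q]%SET).
Proof.
apply: (iffP idP) => [LT|[l]]; last by apply: contraNneq => ->; rewrite finset.in_setT.
apply/existsP; apply: contraNT LT => /existsPn LT; apply/eqP/setP => l.
by rewrite finset.in_setT; apply/negPn/LT.
Qed.

Lemma maxv_ge z q : z q <= maxv z.
Proof. exact: le_bigmax. Qed.

Lemma minv_le z q : minv z <= z q.
Proof. exact: bigmin_le. Qed.

Lemma maxv_attained z : exists q, maxv z = z q.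
Proof.
rewrite /maxv; elim/big_ind: _ => [|x y [q ->] [r ->]|q _]; first by exists ord0.
  by rewrite maxEle; case: ifP => _; [exists r|exists q].
by exists q.
Qed.

Lemma minv_attained z : exists q, minv z = z q.
Proof.
rewrite /minv; elim/big_ind: _ => [|x y [q ->] [r ->]|q _]; first by exists ord0.
  by rewrite minEle; case: ifP => _; [exists q|exists r].
by exists q.
Qed.

Lemma gap_ge0 z L : 0 <= gap z L.
Proof. by rewrite /gap le_max lexx. Qed.

Lemma gap_neq0 z L : gap z L != 0 -> [/\ L != finset.set0, L != finset.setT &
  forall k l, k \in L -> l \notin L -> z l < z k].
Proof.
move=> g0; have : 0 < gap z L by rewrite lt0r g0 gap_ge0.
rewrite /gap lt_max ltxx /= subr_gt0 => lt.
have mm q : minv z <= z q <= maxv z by rewrite minv_le maxv_ge.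
split.
- apply: contraTneq lt => ->; rewrite [ltRHS]big_pred0 => [|k]; last first.
    by rewrite finset.in_set0.
  rewrite -leNgt; have [q ->] := maxv_attained z.
  by apply: le_bigmax_cond; rewrite finset.in_set0.
- apply: contraTneq lt => ->; rewrite [ltLHS]big_pred0 => [|k]; last first.
    by rewrite finset.in_setT.
  rewrite -leNgt; have [q ->] := minv_attained z.
  by apply: bigmin_le_cond; rewrite finset.in_setT.
move=> k l kL lL; apply: le_lt_trans (lt_le_trans lt _).
  exact: le_bigmax_cond.
exact: bigmin_le_cond.
Qed.

Lemma gap_ge z L c : L != finset.set0 -> L != finset.setT ->
  (forall k l, k \in L -> l \notin L -> c <= z k - z l) -> c <= gap z L.
Proof.
move=> /finset.set0Pn[k0 k0L] /neq_setTP[l0 l0L] h.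
have hk k : k \in L -> \big[Num.max/minv z]_(l | l \notin L) z l <= z k - c.
  move=> kL; apply: bigmax_le => [|l lL]; last by have := h k l kL lL; lra.
  by have := h k l0 kL l0L; have := minv_le z l0; lra.
rewrite /gap le_max lerBrDr -lerBrDl; apply/orP; right.
rewrite lerBrDl; apply: le_bigmin => [|k kL]; last by have := hk k kL; lra.
by have := hk k0 k0L; have := maxv_ge z k0; lra.
Qed.

Lemma gap_affine z L c d : 0 <= c -> gap (fun q => (z q - d) * c) L = gap z L * c.
Proof.
move=> c0; pose phi x := (x - d) * c.
have phi_max : {morph phi : x y / Num.max x y}.
  by move=> x y; rewrite /phi addr_maxl maxr_pMl.
have phi_min : {morph phi : x y / Num.min x y}.
  by move=> x y; rewrite /phi addr_minl minr_pMl.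
have maxE : maxv (phi \o z) = phi (maxv z).
  by rewrite /maxv (big_morph phi phi_max (erefl _)).
have minE : minv (phi \o z) = phi (minv z).
  by rewrite /minv (big_morph phi phi_min (erefl _)).
rewrite -[fun q => _]/(phi \o z) /gap maxE minE.
rewrite -(big_morph phi phi_max (erefl _)) -(big_morph phi phi_min (erefl _)).
rewrite maxr_pMl // mul0r; congr (Num.max _ _); rewrite /phi; ring.
Qed.

(** By [gap_neq0] only upper level sets can have a nonzero gap; for these the gap is the jump to the
    next lower value. *)
Lemma gap_next z j j' : z j' < z j -> (forall q, z q < z j -> z q <= z j') ->
  gap z [set q | z j <= z q]%SET = z j - z j'.
Proof.
move=> j'j nxt; set L := [set q | z j <= z q]%SET.
have jL : j \in L by rewrite inE.
have j'L : j' \notin L by rewrite inE -ltNge.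
apply/eqP; rewrite eq_le; apply/andP; split; last first.
  apply: gap_ge => [||k l].
  - by apply/finset.set0Pn; exists j.
  - by apply/neq_setTP; exists j'.
  rewrite !inE -ltNge => jk lj; have := nxt l lj; lra.
rewrite /gap ge_max subr_ge0 ltW //=.
by apply: lerB; [exact: bigmin_le_cond|exact: le_bigmax_cond].
Qed.

(** The upper level sets containing [j] are cut at the values up to [z j], and the jumps telescope
    down to the minimum. *)
Lemma gap_sum z j : \sum_(L : {set Q} | j \in L) gap z L = z j - minv z.
Proof.
move: {2}#|_|.+1 (ltnSn #|[set q | z q < z j]%SET|) => m.
elim: m => // m IH in j *; rewrite ltnS => jm.
have [k0 /= k0j|no] := pickP (fun q => z q < z j); last first.
  have -> : minv z = z j.
    by have [q e] := minv_attained z; apply/eqP; rewrite eq_le minv_le e leNgt no.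
  rewrite subrr big1 // => L jL; apply/eqP/negPn/negP => /gap_neq0[_ LT h].
  have /neq_setTP[l lL] := LT; have := h j l jL lL.
  by rewrite no.
pose j' := [arg max_(i > k0 | z i < z j) z i]%O.
have [j'j nxt] : z j' < z j /\ forall q, z q < z j -> z q <= z j'.
  by rewrite /j'; case: arg_maxP => // i ij h.
have {}IH : \sum_(L : {set Q} | j' \in L) gap z L = z j' - minv z.
  apply: IH; apply: leq_trans jm; apply: proper_card; apply/properP; split.
    by apply/fintype.subsetP => q; rewrite !inE => /lt_trans; apply.
  by exists j'; rewrite !inE ?ltxx.
set L := [set q | z j <= z q]%SET.
have jL : j \in L by rewrite inE.
rewrite (bigD1 L) //= (gap_next j'j nxt) -[RHS](subrKA (z j')) -IH; congr (_ + _).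
(* No value lies strictly between [z j'] and [z j], so [L] is the only set of nonzero gap that
   separates [j] from [j']. *)
rewrite big_mkcond [RHS]big_mkcond; apply: eq_bigr => M _.
have [-> |gM] := eqVneq (gap z M) 0; first by rewrite !if_same.
have [_ _ h] := gap_neq0 gM.
suff -> : (j \in M) && (M != L) = (j' \in M) by [].
apply/andP/idP => [[jM ML]|j'M]; last first.
  split; last by apply: contraTneq j'M => ->; rewrite inE -ltNge.
  by apply/negPn/negP => jM; have := h _ _ j'M jM; rewrite ltNge ltW.
apply/negPn/negP => j'M; case/negP: ML; rewrite finset.eqEsubset.
apply/andP; split; apply/fintype.subsetP => q; rewrite inE.
  by move=> qM; rewrite leNgt; apply/negP => /nxt; rewrite leNgt h.
by move=> jq; apply/negPn/negP => qM; have := h _ _ jM qM; rewrite ltNge jq.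
Qed.

(** A set of nonzero gap contains every index where the maximum is attained, so this is [gap_sum] at
    such an index. *)
Lemma gap_total z : \sum_L gap z L = maxv z - minv z.
Proof.
have [j e] := maxv_attained z; rewrite e -gap_sum [RHS]big_mkcond.
apply: eq_bigr => L _; case: ifP => // /negbT jL.
apply/eqP/negPn/negP => /gap_neq0[/finset.set0Pn[k kL] _ h].
by have := h k j kL jL; rewrite ltNge -e maxv_ge.
Qed.

Lemma gap_eq0_cst z : \sum_L gap z L = 0 -> forall j, z j = z ord0.
Proof.
rewrite gap_total => /eqP; rewrite subr_eq0 => /eqP e j; apply/eqP.
by rewrite eq_le; apply/andP; split;
  [apply: le_trans (maxv_ge z j) _|apply: le_trans (maxv_ge z ord0) _];
  rewrite e minv_le.
Qed.

Lemma continuous_gap (Y : topologicalType) (z : Y -> Q -> R) L :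
  (forall q, continuous (fun y => z y q)) -> continuous (fun y => gap (z y) L).
Proof.
move=> cz; apply: continuous_fct_max; first exact: continuous_fct_cst.
have cmaxv : continuous (fun y => maxv (z y)).
  apply: continuous_fct_big => // *; exact: continuous_fct_max.
have cminv : continuous (fun y => minv (z y)).
  apply: continuous_fct_big => // *; exact: continuous_fct_min.
apply: continuous_fct_add; last apply: continuous_fct_opp.
  apply: continuous_fct_big => // *; exact: continuous_fct_min.
apply: continuous_fct_big => // *; exact: continuous_fct_max.
Qed.

End Gap.

(** * The sphere of proper nonempty subsets *)

Section Sphere.
Variables (R : realType) (T : choiceType) (le : T -> T -> Prop) (P : set T).
Hypothesis finP : finite_set P.
Hypothesis leT : forall q p r, le p q -> le q r -> le p r.
Hypothesis leA : forall p q, le p q -> le q p -> p = q.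
Notation K := (order_complex le P).
Notation X := (realization R K).
Notation PF := (fset_set P).

Variable n : nat.
Notation Q := 'I_n.+2.
Variables (D : T -> {set Q}) (om : {set Q} -> T).
Hypothesis D_neq0 : forall p, P p -> D p != finset.set0.
Hypothesis D_neqT : forall p, P p -> D p != finset.setT.
Hypothesis D_mono : forall p q, P p -> P q -> le p q -> D p \subset D q.
Hypothesis om_le : forall p, P p -> le (om (D p)) p.
Hypothesis om_mono : forall L M : {set Q}, L \subset M -> le (om L) (om M).
Hypothesis omP : forall L : {set Q}, L != finset.set0 -> L != finset.setT -> P (om L).
Hypothesis omK : forall L : {set Q}, L != finset.set0 -> L != finset.setT -> D (om L) = L.

Notation S := (@unit_sphere R n.+1).

Definition height (x : X) (q : Q) : R := \sum_(p : PF) x (val p) * (q \in D (val p))%:R.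

Definition mass (x : X) (L : {set Q}) : R := \sum_(p : PF) x (val p) * (D (val p) == L)%:R.

Lemma sum_mass x : \sum_L mass x L = 1.
Proof.
rewrite /mass exchange_big -[RHS](point_sum finP x); apply: eq_bigr => p _ /=.
rewrite -mulr_sumr (bigD1 (D (val p))) //= eqxx big1 ?addr0 ?mulr1 // => L LD.
by rewrite eq_sym (negbTE LD).
Qed.

(** Points of the support form a chain, so each [D p] contains [L] or lies in it. For [k] in [L] and
    [l] outside, every [p] then contributes nonnegatively to the difference of heights, and those
    with [D p = L] contribute their whole coordinate. *)
Lemma mass_le_gap x L : mass x L <= gap (height x) L.
Proof.
have [->|m0] := eqVneq (mass x L) 0; first exact: gap_ge0.
have [p0 xp0 DL] : exists2 p : PF, x (val p) != 0 & D (val p) = L.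
  apply: contrapT => no; move/eqP: m0; apply; apply: big1 => p _.
  have [->|xp] := eqVneq (x (val p)) 0; first by rewrite mul0r.
  by case: eqP => [e|_]; [case: no; exists p|rewrite mulr0].
have PL := point_supp xp0; rewrite -DL.
apply: gap_ge => [||k l kL lL]; [exact: D_neq0|exact: D_neqT|].
rewrite /height -sumrB; apply: ler_sum => p _; rewrite -mulrBr.
have [->|xp] := eqVneq (x (val p)) 0; first by rewrite !mul0r.
apply: ler_wpM2l; first exact: coord_ge0.
have Pp := point_supp xp; have := point_chain xp xp0.
case: eqP => [->|ne]; first by rewrite kL (negbTE lL) subr0.
move=> [pp0|p0p].
  have /fintype.subsetP sub := D_mono Pp PL pp0.
  rewrite (_ : l \in _ = false) ?subr0 ?ler0n //.
  by apply: contraNF lL; apply: sub.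
have /fintype.subsetP sub := D_mono PL Pp p0p.
by rewrite (sub k kL) subr_ge0 lern1; case: (_ \in _).
Qed.

Lemma height01 x q : 0 <= height x q <= 1.
Proof.
apply/andP; split.
  by apply: sumr_ge0 => p _; rewrite mulr_ge0 ?coord_ge0 ?ler0n.
rewrite -(point_sum finP x); apply: ler_sum => p _.
by rewrite ler_piMr ?coord_ge0 // lern1; case: (_ \in _).
Qed.

(* Both sides have total at most 1, and the masses already add up to 1. *)
Lemma gap_height x L : gap (height x) L = mass x L.
Proof.
have tot : \sum_L gap (height x) L <= 1.
  rewrite gap_total; have [j ->] := maxv_attained (height x).
  have [i ->] := minv_attained (height x).
  by have := height01 x i; have := height01 x j; lra.
apply/eqP; rewrite eq_le mass_le_gap andbT -subr_ge0.
have : 0 <= \sum_(M | M != L) (gap (height x) M - mass x M).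
  by apply: sumr_ge0 => M _; rewrite subr_ge0 mass_le_gap.
rewrite sumrB; move: tot (sum_mass x).
by rewrite (bigD1 L) //= => tot; rewrite (bigD1 L) //=; lra.
Qed.

(** Coordinates on functions modulo constants, normalized to vanish at [ord0]; [ext] restores that
    zero. *)
Definition hdiff (x : X) (k : 'I_n.+1) : R := height x (lift ord0 k) - height x ord0.

Definition hnorm (x : X) : R := Num.sqrt (\sum_k hdiff x k ^+ 2).

(** A constant height has only zero gaps, whereas the masses, which are the gaps, add up to 1. *)
Lemma hnorm_gt0 x : 0 < hnorm x.
Proof.
rewrite sqrtr_gt0 lt0r sumr_ge0 ?andbT => [|k _]; last exact: sqr_ge0.
apply/eqP => /psumr_eq0P h0.
have hE q : height x q = height x ord0.
  case: (unliftP ord0 q) => [k ->|-> //]; apply/eqP; rewrite -subr_eq0.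
  by rewrite -sqrf_eq0; apply/eqP/(h0 (fun k _ => sqr_ge0 (hdiff x k))).
have : \sum_L mass x L = 0.
  under eq_bigr do rewrite -gap_height.
  rewrite gap_total; have [j ->] := maxv_attained (height x).
  by have [i ->] := minv_attained (height x); rewrite !hE subrr.
by rewrite sum_mass => /eqP; rewrite oner_eq0.
Qed.

Definition to_vec (x : X) : 'rV[R]_n.+1 := \row_k (hdiff x k / hnorm x).

Lemma to_vec_sphere x : unit_sphere (to_vec x).
Proof.
rewrite /unit_sphere /=; under eq_bigr do rewrite mxE expr_div_n.
rewrite -mulr_suml sqr_sqrtr; last by apply: sumr_ge0 => k _; exact: sqr_ge0.
by rewrite divff // gt_eqF // -sqrtr_gt0 hnorm_gt0.
Qed.

Definition ext (z : 'rV[R]_n.+1) (q : Q) : R :=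
  if unlift ord0 q is Some k then z ord0 k else 0.

Lemma ext0 z : ext z ord0 = 0.
Proof. by rewrite /ext unlift_none. Qed.

Lemma ext_lift z k : ext z (lift ord0 k) = z ord0 k.
Proof. by rewrite /ext liftK. Qed.

Lemma ext_to_vec x q : ext (to_vec x) q = (height x q - height x ord0) / hnorm x.
Proof.
case: (unliftP ord0 q) => [k ->|->]; first by rewrite ext_lift mxE.
by rewrite ext0 subrr mul0r.
Qed.

(** By [gap_total] this is maximum minus minimum; as a sum of gaps it makes the weights add up to 1
    at once. *)
Definition total (z : 'rV[R]_n.+1) : R := \sum_L gap (ext z) L.

Lemma total_gt0 (z : 'rV[R]_n.+1) : unit_sphere z -> 0 < total z.
Proof.
move=> z1; rewrite lt0r sumr_ge0 ?andbT => [|L _]; last exact: gap_ge0.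
apply/eqP => /gap_eq0_cst e; move: z1; rewrite /unit_sphere /= big1 => [/eqP|k _].
  by rewrite eq_sym oner_eq0.
by rewrite -ext_lift e ext0 expr0n.
Qed.

Definition weight (z : 'rV[R]_n.+1) (L : {set Q}) : R := gap (ext z) L / total z.

Lemma weight_weights (z : 'rV[R]_n.+1) : unit_sphere z ->
  simplicial_weights le P om (weight z).
Proof.
move=> /total_gt0 t0; have gw L : weight z L != 0 -> gap (ext z) L != 0.
  by apply: contra_neq => g0; rewrite /weight g0 mul0r.
split=> [L||L /gw/gap_neq0[L0 LT _]|L M /gw/gap_neq0[_ _ hL] /gw/gap_neq0[_ _ hM]].
- by rewrite divr_ge0 ?gap_ge0 ?ltW.
- by rewrite -mulr_suml divff ?gt_eqF.
- exact: omP.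
have [/om_mono|/fintype.subsetPn[k kL kM]] := boolP (L \subset M); first by left.
right; apply/om_mono/fintype.subsetP => l lM; apply/negPn/negP => lL.
by have := lt_trans (hL k l kL lL) (hM l k lM kM); rewrite ltxx.
Qed.

Lemma weight_to_vec x L : weight (to_vec x) L = mass x L.
Proof.
have gE M : gap (ext (to_vec x)) M = mass x M * (hnorm x)^-1.
  rewrite -gap_height -(gap_affine (height x) M (height x ord0)); last first.
    by rewrite invr_ge0 ltW ?hnorm_gt0.
  by congr gap; apply/funext => q; exact: ext_to_vec.
rewrite /weight /total gE; under eq_bigr do rewrite gE.
by rewrite -mulr_suml sum_mass mul1r invrK mulfVK // gt_eqF ?hnorm_gt0.
Qed.

(** [f \o g] is the identity on the nose, while [g \o f] pushes the mass of each [p] to [om (D p)],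
    so that [retraction_homotopic] applies. *)
Lemma sphere_equivalence : homotopy_equivalent R X (sphere R n).
Proof.
have /choice[f fE] : forall x, exists y : S, set_val y = to_vec x.
  by move=> x; exists (SigSub (mem_set (to_vec_sphere x))).
have c_height q : continuous (fun x : X => height x q).
  apply: continuous_fct_sum => p _; apply: continuous_fct_mul.
    exact: realization_coord_continuous.
  exact: continuous_fct_cst.
have c_hdiff k : continuous (fun x : X => hdiff x k).
  by apply: continuous_fct_add => //; apply: continuous_fct_opp.
have c_hnorm : continuous hnorm.
  move=> x; apply: (@continuous_comp _ _ _ (fun x => \sum_k hdiff x k ^+ 2) Num.sqrt).
    by apply: continuous_fct_sum => k _; apply: continuous_fct_mul.
  exact: sqrt_continuous.
have cf : continuous f.
  apply: continuous_set_type; rewrite (_ : (fun _ => _) = to_vec); last exact/funext.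
  apply: continuous_mx => i k; rewrite (_ : (fun _ => _) = fun x => hdiff x k / hnorm x).
    apply: continuous_fct_mul => //; apply: continuous_fct_inv => // x.
    by rewrite gt_eqF ?hnorm_gt0.
  by apply/funext => x; rewrite mxE.
have Sv (y : S) : unit_sphere (set_val y) by exact/set_mem/valP.
have c_val k : continuous (fun y : S => (set_val y : 'rV[R]_n.+1) ord0 k).
  move=> y; apply: (@continuous_comp _ _ _ (set_val : S -> 'rV[R]_n.+1) (fun z => z ord0 k)).
    exact: initial_continuous.
  exact: coord_continuous.
have c_ext q : continuous (fun y : S => ext (set_val y) q).
  rewrite /ext; case: (unlift _ _) => [k|]; first exact: c_val.
  exact: continuous_fct_cst.
have c_gap L : continuous (fun y : S => gap (ext (set_val y)) L).
  exact: continuous_gap.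
have c_weight L : continuous (fun y : S => weight (set_val y) L).
  apply: continuous_fct_mul => //; apply: continuous_fct_inv => [y|].
    by rewrite gt_eqF ?total_gt0.
  exact: continuous_fct_sum.
have [g cg gE] := weights_map finP (fun y : S => weight_weights (Sv y)) c_weight.
exists f, g; split=> //.
  apply: (@retraction_homotopic _ _ _ _ finP leT leA (om \o D)) => //.
  - by move=> p Pp; apply: omP; [exact: D_neq0|exact: D_neqT].
  - by move=> p q Pp Pq pq; apply/om_mono/D_mono.
  move=> x t; rewrite /= gE fE /push; under eq_bigr do rewrite weight_to_vec mulr_suml.
  rewrite exchange_big; apply: eq_bigr => p _ /=.
  rewrite (bigD1 (D (val p))) //= eqxx mulr1 big1 ?addr0 // => L LD.
  by rewrite eq_sym (negbTE LD) mulr0 mul0r.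
suff fgK y : f (g y) = y.
  by exists fst; split=> [|x|x] //=; apply: continuous_subspaceT => y; exact: cvg_fst.
apply/val_inj; rewrite -[LHS]/(set_val (f (g y))) -[RHS]/(set_val y) fE.
set z := set_val y; have z1 := Sv y; have t0 := total_gt0 z1.
(* By [gap_sum] the heights recover [ext z] up to a translation and the factor [total z]; taking
   differences removes the first and normalizing the second, as [z] has norm 1. *)
have hE q : height (g y) q = (ext z q - minv (ext z)) / total z.
  rewrite /height; under eq_bigr do rewrite gE.
  rewrite (mean_push finP (fun t => (q \in D t)%:R)); last first.
    by move=> L; have [_ _ + _] := weight_weights z1; apply.
  rewrite -gap_sum mulr_suml [RHS]big_mkcond; apply: eq_bigr => L _.
  rewrite -/z -/(weight _ _).
  have [w0|w0] := eqVneq (weight z L) 0; first by rewrite w0 mul0r if_same.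
  have /gap_neq0[L0 LT _] : gap (ext z) L != 0.
    by apply: contra_neq w0 => g0; rewrite /weight g0 mul0r.
  by rewrite omK //; case: (q \in L); rewrite ?mulr1 ?mulr0.
have dE k : hdiff (g y) k = z ord0 k / total z.
  by rewrite /hdiff !hE ext0 ext_lift -mulrBl; congr (_ / _); ring.
have nE : hnorm (g y) = (total z)^-1.
  rewrite /hnorm; under eq_bigr do rewrite dE expr_div_n.
  rewrite -mulr_suml z1 mul1r -exprVn sqrtr_sqr ger0_norm // invr_ge0 ltW //.
apply/matrixP => i k; rewrite mxE dE nE invrK mulfVK ?gt_eqF //.
by rewrite (ord1 i).
Qed.

End Sphere.

(** * Empty spheres and the conclusion *)

Lemma homotopy_equivalent_empty (R : realType) (X Y : topologicalType) :
  (X -> False) -> (Y -> False) -> homotopy_equivalent R X Y.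
Proof.
move=> X0 Y0; exists (fun x => False_rect Y (X0 x)), (fun y => False_rect X (Y0 y)).
split; [by move=> x; case: (X0 x)|by move=> y; case: (Y0 y)| |].
- exists fst; split; [|by move=> x; case: (X0 x)..].
  by apply: continuous_subspaceT => -[x]; case: (X0 x).
- exists fst; split; [|by move=> y; case: (Y0 y)..].
  by apply: continuous_subspaceT => -[y]; case: (Y0 y).
Qed.

Lemma realization_empty (R : realType) (T : choiceType) (le : T -> T -> Prop)
  (P : set T) : (forall p, ~ P p) -> realization R (order_complex le P) -> False.
Proof.
move=> P0 x; have [s [[s0 sP _] _ _]] := coord_simplex x.
by have /fset0Pn[p /sP/P0] := s0.
Qed.

Lemma unit_sphere0 (R : realType) : @unit_sphere R 0 -> False.
Proof.
move=> y; have := set_mem (valP y); rewrite /unit_sphere /= big_ord0 => /eqP.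
by rewrite eq_sym oner_eq0.
Qed.

Theorem theorem3p13 (R : realType) (I A : finType) (C : cartanScheme I A)
    (hC : finite_root_system C (real_roots C))
    (a : A) (u v : homTo C a) (huv : weak_le u v) :
  let w := ldiv u v in
  let J := left_descents w in
  let X := realization R (order_complex (@weak_le I A C a) (weak_interval u v)) in
  (w <> longest C J (tag u) -> contractible R X) /\
  (w = longest C J (tag u) -> homotopy_equivalent R X (sphere R (#|J|%:Z - 2))).
Proof.
have [D [om [[finP DP Dmono omm Dom] [cw sw]]]] := weak_interval_retraction hC huv.
set w := ldiv u v in DP Dmono omm Dom cw sw *; set J := left_descents w in DP omm Dom cw sw *.
have leR := weak_le_refl hC (a := a).
have leT := weak_le_trans hC (a := a).
have leA := weak_le_anti hC (a := a).
split=> [/cw[J0 omP]|/sw[omP DnJ]].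
  apply: (@contractible_above _ _ _ _ finP leR leT leA (om \o D) _ _ _ (om J)) => //.
  - by move=> p /DP[DJ D0 _]; apply: omP.
  - by move=> p /DP[].
  - by move=> p q Pp Pq pq; have [DJ _ _] := DP q Pq; apply: omm (Dmono p q Pp Pq pq) DJ.
  - exact: omP.
  - by move=> p /DP[DJ _ _]; apply: omm.
case e : #|J| => [|[|n]].
(* Here [u = v]: the dimension is -2, and [sphere] is empty in every negative dimension. *)
- apply: homotopy_equivalent_empty; last exact: unit_sphere0.
  apply: realization_empty => p Pp; have [DJ D0 _] := DP p Pp.
  by have := subset_leq_card DJ; rewrite e leqn0 cards_eq0 (negbTE D0).
(* With one descent, [v] covers [u]: a nonempty subset of [J] is [J] itself, which [DnJ]
   excludes. *)
- apply: homotopy_equivalent_empty; last exact: unit_sphere0.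
  apply: realization_empty => p Pp; have [DJ D0 _] := DP p Pp.
  have := DnJ p Pp; rewrite eqEcard DJ e -ltnNge ltnS leqn0 cards_eq0.
  by rewrite (negbTE D0).
have -> : n.+2%:Z - 2 = n by lia.
(* The sphere is modelled on subsets of an ordinal; [phi] numbers the elements of [J], and [D] and
   [om] are transported along it. *)
pose phi (q : 'I_n.+2) : I := enum_val (cast_ord (esym e) q).
have phi_inj : injective phi by move=> q r /enum_val_inj/cast_ord_inj.
have phiJ q : phi q \in J by apply: enum_valP.
have phi_onto i : i \in J -> exists q, i = phi q.
  move=> iJ; exists (cast_ord e (enum_rank_in iJ i)).
  by rewrite /phi cast_ordK enum_rankK_in.
have imJ (L : {set 'I_n.+2}) : phi @: L \subset J.
  by apply/fintype.subsetP => _ /imsetP[q _ ->].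
have pre_im (L : {set 'I_n.+2}) : [set q | phi q \in phi @: L]%SET = L.
  by apply/setP => q; rewrite inE mem_imset.
have im_pre p : weak_interval u v p -> phi @: [set q | phi q \in D p]%SET = D p.
  move=> /DP[/fintype.subsetP DJ _ _]; apply/setP => i; apply/imsetP/idP.
    by move=> [q]; rewrite inE => ? ->.
  move=> iD; have [q iq] := phi_onto i (DJ i iD); exists q => //.
  by rewrite inE -iq.
have im0 (L : {set 'I_n.+2}) : L != finset.set0 -> phi @: L != finset.set0.
  by move=> /finset.set0Pn[q qL]; apply/finset.set0Pn; exists (phi q); apply: imset_f.
have imT : phi @: [set: 'I_n.+2]%SET = J.
  apply/setP => i; apply/imsetP/idP => [[q _ ->] //|/phi_onto[q ->]].
  by exists q; rewrite ?inE.
apply: (@sphere_equivalence _ _ _ _ finP leT leA n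
  (fun p => [set q | phi q \in D p]%SET) (fun L => om (phi @: L))).
- move=> p Pp; have [_ + _] := DP p Pp; apply: contra_neq => e0.
  by rewrite -im_pre // e0 imset0.
- move=> p Pp; have := DnJ p Pp; apply: contra_neq => eT.
  by rewrite -im_pre // eT imT.
- move=> p q Pp Pq /(Dmono p q Pp Pq)/fintype.subsetP sub.
  by apply/fintype.subsetP => k; rewrite !inE; apply: sub.
- by move=> p Pp; rewrite /= im_pre //; have [] := DP p Pp.
- by move=> L M LM; apply: omm; [apply: imsetS|].
- move=> L L0 LT; apply: omP => //; first exact: im0.
  apply: contra_neq LT => LJ; rewrite -[L]pre_im LJ.
  by apply/setP => q; rewrite finset.in_setT inE; exact: phiJ.
- by move=> L _ _; rewrite Dom.
Qed.
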